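(* Let $0<p<q<\infty$, and let $\{p,\kappa_{d,p}\}$ and $\{q,\kappa_{d,q}\}$ have asymptotic sizes in $(0,1)$. Then, for every $\boldsymbol{\vartheta}=\{\boldsymbol{\theta}_d:d\in\mathbb{N}\}\in\mathscr{C}(\{q,\kappa_{d,q}\})\setminus\mathscr{C}(\{p,\kappa_{d,p}\})$, $\boldsymbol{\theta}_d=(\theta_{1,d},\dots,\theta_{d,d})$, the following holds: 1. For every $\delta\in(0,\infty)$ there exists a subsequence $d'$ of $d$ such that $$\sup_{d'}\frac{\sum_{i=1}^{d'}\mathbf{1}\{|\theta_{i,d'}|>\delta\}}{\sqrt{d'}}<\infty\quad\text{and}\quad \max_{1\le i\le d'}|\theta_{i,d'}|\to\infty.$$ 2. If $p\ge 2$, then there exists a subsequence $d'$ of $d$ such that $$\sup_{\delta\in(0,\infty)}\ \delta^p\times\sup_{d'}\frac{\sum_{i=1}^{d'}\mathbf{1}\{|\theta_{i,d'}|>\delta\}}{\sqrt{d'}}<\infty\quad\text{and}\quad \max_{1\le i\le d'}|\theta_{i,d'}|\to\infty.$$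
   Context: Let $\varepsilon_1,\varepsilon_2,\dots$ be i.i.d. standard normal random variables and $\boldsymbol{\varepsilon}_d = (\varepsilon_1,\dots,\varepsilon_d)$. A (sequence of) test(s) is a sequence $\varphi_d$, $d\in\mathbb{N}$, of Borel measurable functions $\varphi_d:\mathbb{R}^d \to [0,1]$; it has asymptotic size $\alpha\in[0,1]$ if $\lim_{d\to\infty}\mathbb{E}(\varphi_d(\boldsymbol{\varepsilon}_d)) = \alpha$. Let $\boldsymbol{\Theta} := \prod_{d=1}^\infty \mathbb{R}^d$ be the set of all triangular arrays $\boldsymbol{\vartheta} = \{\boldsymbol{\theta}_d: d\in\mathbb{N}\}$, $\boldsymbol{\theta}_d\in\mathbb{R}^d$. The consistency set $\mathscr{C}(\varphi_d)\subseteq\boldsymbol{\Theta}$ of a sequence of tests $\varphi_d$ is the set of all $\boldsymbol{\vartheta}\in\boldsymbol{\Theta}$ with $\lim_{d\to\infty}\mathbb{E}(\varphi_d(\boldsymbol{\theta}_d+\boldsymbol{\varepsilon}_d)) = 1$. For $\boldsymbol{x}\in\mathbb{R}^d$ and $p\in(0,\infty)$, $\|\boldsymbol{x}\|_p := (\sum_{i=1}^d |x_i|^p)^{1/p}$ (also for $p<1$). For a sequence of real critical values $\kappa_d$, $\{p,\kappa_d\}$ denotes the sequence of tests $\mathbf{1}\{\|\cdot\|_p \ge \kappa_d\}$. A subsequence $d'$ of $d$ is a strictly increasing sequence of natural numbers; suprema over $d'$ and limits are taken over the members of that sequence. *)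

(* Defs.v *)
From HB Require Import structures.
From mathcomp Require Import all_boot all_order all_algebra finmap.
From mathcomp Require Import all_classical all_reals all_analysis.
From mathcomp Require Import measurable_realfun.
Set Implicit Arguments.
Unset Strict Implicit.
Unset Printing Implicit Defensive.
Import Order.TTheory GRing.Theory Num.Theory.
Import numFieldNormedType.Exports.
Local Open Scope classical_set_scope.
Local Open Scope ring_scope.

(* Sequences indexed by the dimension d are functions on nat. The term d = 0 is
   a harmless addition: R^0 is a point, limits along \oo ignore it, and it is
   excluded from subsequences. Coordinates are numbered from 0. *)

(* The sigma-algebra on d.-tuple R is the product sigma-algebra, which is the
   Borel sigma-algebra of R^d. *)
Record test (R : realType) (d : nat) := Test {
  test_fun :> d.-tuple R -> R;
  measurable_test : measurable_fun [set: d.-tuple R] test_fun;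
  test_ge0_le1 : forall x, 0 <= test_fun x <= 1
}.

Definition triangular_array (R : realType) := forall d : nat, d.-tuple R.

Definition mutually_independent (disp : measure_display)
    (T : measurableType disp) (R : realType) (P : probability T R)
    (X : nat -> {RV P >-> R}) : Prop :=
  forall (J : {fset nat}) (A : nat -> set R), (forall i, measurable (A i)) ->
    P (\bigcap_(i in [set` J]) (X i @^-1` A i)) =
    (\prod_(i <- J) P (X i @^-1` A i))%E.

Definition iid_standard_normal (disp : measure_display)
    (T : measurableType disp) (R : realType) (P : probability T R)
    (X : nat -> {RV P >-> R}) : Prop :=
  mutually_independent X /\
  forall i (A : set R), measurable A ->
    distribution P (X i) A = normal_prob 0 1 A.

Definition noise (disp : measure_display) (T : measurableType disp)
    (R : realType) (P : probability T R) (eps : nat -> {RV P >-> R})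
    (d : nat) (w : T) : d.-tuple R :=
  [tuple eps i w | i < d].

Definition tuple_add (R : realType) (d : nat) (x y : d.-tuple R) : d.-tuple R :=
  [tuple tnth x i + tnth y i | i < d].

Definition asymptotic_size (disp : measure_display) (T : measurableType disp)
    (R : realType) (P : probability T R) (eps : nat -> {RV P >-> R})
    (phi : forall d, test R d) (alpha : R) : Prop :=
  'E_P[fun w => phi d (noise eps d w)]%E @[d --> \oo] --> alpha%:E.

Definition consistency_set (disp : measure_display) (T : measurableType disp)
    (R : realType) (P : probability T R) (eps : nat -> {RV P >-> R})
    (phi : forall d, test R d) : set (triangular_array R) :=
  [set theta | 'E_P[fun w => phi d (tuple_add (theta d) (noise eps d w))]%E
               @[d --> \oo] --> 1%:E].

Definition pnorm (R : realType) (p : R) (d : nat) (x : d.-tuple R) : R :=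
  (\sum_(i < d) `|tnth x i| `^ p) `^ p^-1.

Lemma measurable_pnorm (R : realType) (p : R) (d : nat) :
  measurable_fun [set: d.-tuple R] (@pnorm R p d).
Proof.
apply: (measurableT_comp (measurable_powR _)).
apply: measurable_sum => i.
apply: (measurableT_comp (measurable_powR _)).
apply: measurableT_comp => //.
exact: measurable_tnth.
Qed.

Section norm_test.
Variables (R : realType) (p : R) (kappa : nat -> R) (d : nat).

Let rejection_region : set (d.-tuple R) := [set x | kappa d <= pnorm p x].

Let measurable_norm_test :
  measurable_fun [set: d.-tuple R] (\1_rejection_region : d.-tuple R -> R).
Proof.
apply: measurable_indic.
rewrite -[X in measurable X]setTI.
have -> : rejection_region = @pnorm R p d @^-1` `[kappa d, +oo[.
  by apply/seteqP; split => x; rewrite /= in_itv/= andbT.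
exact: measurable_pnorm.
Qed.

Let norm_test_ge0_le1 x : 0 <= (\1_rejection_region x : R) <= 1.
Proof. by rewrite indicE; case: (_ \in _); rewrite lexx ler01. Qed.

Definition norm_test : test R d := Test measurable_norm_test norm_test_ge0_le1.

End norm_test.

Definition subsequence (s : nat -> nat) : Prop :=
  (forall n, (0 < s n)%N) /\ {homo s : m n / (m < n)%N}.

Definition exceedance_ratio (R : realType) (theta : triangular_array R)
    (delta : R) (d : nat) : R :=
  (\sum_(i < d) (delta < `|tnth (theta d) i|)%R%:R) / Num.sqrt d%:R.

(* The default value 0 of the iterated maximum has no effect when 0 < d. *)
Definition max_abs (R : realType) (theta : triangular_array R) (d : nat) : R :=
  \big[Num.max/0]_(i < d) `|tnth (theta d) i|.

Definition sup_exceedance_ratio (R : realType) (theta : triangular_array R)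
    (delta : R) (s : nat -> nat) : \bar R :=
  ereal_sup [set (exceedance_ratio theta delta (s n))%:E | n in [set: nat]].

(* Main.v *)
(* Put h_a(x) = E|x+e|^a - E|e|^a for e standard normal, and let T_a be the sum of
   the |theta_i + eps_i|^a, so that the test {a, kappa} compares T_a with a
   critical value c_d. By Chebyshev, an asymptotic size in (0,1) forces
   c_d = d E|e|^a + O(sqrt d).

   If the sum H_p of the h_p(theta_i) were eventually above every multiple of
   sqrt d, Chebyshev again (with Var|x+e|^p <= C + eta h_p(x)^2 for every eta > 0)
   would make {p, kappa} consistent; hence H_p <= K sqrt d along a subsequence.
   The bounds on exceedances follow, as h_p is bounded below away from 0, and
   h_p(x) >= |x|^p for p >= 2.

   If max |theta_i| stayed bounded along part of that subsequence, then
   H_q = O(sqrt d) as well, because h_p and h_q are both of order x^2 on bounded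
   sets. But then the power of {q, kappa} stays away from 1: no central limit
   theorem is needed, since a product tilting of the law with bounded chi-square
   distance pushes T_q below c_d with probability at least 1/2. *)

Require Import Defs.
From HB Require Import structures.
From mathcomp Require Import all_boot all_order all_algebra finmap.
From mathcomp Require Import all_classical all_reals all_analysis.
From mathcomp Require Import measurable_realfun.
From mathcomp Require Import ring lra.
Set Implicit Arguments.
Unset Strict Implicit.
Unset Printing Implicit Defensive.
Import Order.TTheory GRing.Theory Num.Theory.
Import numFieldNormedType.Exports.
Local Open Scope classical_set_scope.
Local Open Scope ring_scope.

(** * Expectation of real functions *)

(** The exponents are arbitrary positive reals, so |x|^a need not be differentiable at 0 and h_a
    cannot be expanded by differentiating the power. The shift is carried by the Gaussian density
    instead: h_a(x) is the integral of |y|^a (exp(-x^2/2) cosh(xy) - 1), smooth in x, and both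
    quadratic bounds come from inequalities for cosh. The variance of |x+e|^p cannot be bounded by a
    constant when p > 1. The term eta h_p^2 is harmless because squares of nonnegative numbers sum
    to at most the square of their sum, so Chebyshev's quotient receives only a multiple of eta from
    it. The tilting reweights the indicators of |X_i| <= 1, where X_i = theta_i + eps_i: they are
    bounded, which keeps the density nonnegative, and negatively correlated with |X_i|^q, uniformly
    over bounded shifts. Chebyshev under the tilted law bounds the tilted probability of acceptance
    from below; the inequality L <= lam + L^2/(4 lam) carries the bound back to the original law at
    a cost independent of d. *)

Section expectation_calculus.
Context (disp : measure_display) (T : measurableType disp) (R : realType).
Variable P : probability T R.
Implicit Types f g : T -> R.

Definition L1 f := P.-integrable [set: T] (EFin \o f).

(** The value is the [fine] part of an extended integral, hence meaningful only for integrable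
    functions; this is why several results below state [L1] together with the value of [Ex]. *)
Definition Ex f : R := \int[P]_x f x.

Lemma L1_measurable f : L1 f -> measurable_fun [set: T] f.
Proof. by case/integrableP => /measurable_EFinP. Qed.

Lemma L1_cst c : L1 (fun=> c).
Proof. exact: finite_measure_integrable_cst. Qed.

Lemma L1D f g : L1 f -> L1 g -> L1 (fun x => f x + g x).
Proof. exact: integrableD. Qed.

Lemma L1Zl c f : L1 f -> L1 (fun x => c * f x).
Proof. exact: integrableZl. Qed.

Lemma L1B f g : L1 f -> L1 g -> L1 (fun x => f x - g x).
Proof. exact: integrableB. Qed.

Lemma L1_sum (I : Type) (s : seq I) (F : I -> T -> R) :
  (forall i, L1 (F i)) -> L1 (fun x => \sum_(i <- s) F i x).
Proof.
move=> LF; elim: s => [|i s IH].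
  by under [fun _ => _]eq_fun do rewrite big_nil; exact: L1_cst.
by under [fun _ => _]eq_fun do rewrite big_cons; exact: L1D.
Qed.

Lemma L1_le f g : measurable_fun [set: T] f -> (forall x, `|f x| <= g x) ->
  L1 g -> L1 f.
Proof.
move=> mf fg; apply: le_integrable => //; first exact/measurable_EFinP.
by move=> x _ /=; rewrite lee_fin (le_trans (fg x))// ler_norm.
Qed.

Lemma L1_bounded (c : R) f : measurable_fun [set: T] f ->
  (forall x, `|f x| <= c) -> L1 f.
Proof. by move=> mf fc; apply: L1_le (L1_cst c). Qed.

Lemma EFin_Ex f : L1 f -> (Ex f)%:E = (\int[P]_x (f x)%:E)%E.
Proof. by move=> Lf; rewrite fineK// integrable_fin_num. Qed.

Lemma Ex_cst c : Ex (fun=> c) = c.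
Proof.
rewrite /Ex Rintegral_cst//.
by rewrite [X in fine X](_ : _ = 1%E) ?mulr1//; exact: probability_setT.
Qed.

Lemma ExD f g : L1 f -> L1 g -> Ex (fun x => f x + g x) = Ex f + Ex g.
Proof. exact: RintegralD. Qed.

Lemma ExB f g : L1 f -> L1 g -> Ex (fun x => f x - g x) = Ex f - Ex g.
Proof. exact: RintegralB. Qed.

Lemma ExZl c f : L1 f -> Ex (fun x => c * f x) = c * Ex f.
Proof. exact: RintegralZl. Qed.

Lemma Ex_sum (I : Type) (s : seq I) (F : I -> T -> R) :
  (forall i, L1 (F i)) ->
  Ex (fun x => \sum_(i <- s) F i x) = \sum_(i <- s) Ex (F i).
Proof.
move=> LF; elim: s => [|i s IH].
  under [fun _ => _]eq_fun do rewrite big_nil.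
  by rewrite Ex_cst big_nil.
under [fun _ => _]eq_fun do rewrite big_cons.
by rewrite ExD// ?IH ?big_cons//; exact: L1_sum.
Qed.

Lemma Ex_ge0 f : (forall x, 0 <= f x) -> 0 <= Ex f.
Proof. by move=> f0; exact: Rintegral_ge0. Qed.

Lemma le_Ex f g : L1 f -> L1 g -> (forall x, f x <= g x) -> Ex f <= Ex g.
Proof. by move=> Lf Lg fg; apply: le_Rintegral. Qed.

Lemma L1_indic A : measurable A -> L1 \1_A.
Proof.
move=> mA; apply: (@L1_bounded 1); first exact: measurable_indic.
by move=> x; rewrite indicE; case: (_ \in _); rewrite ?normr0 ?normr1.
Qed.

Lemma Ex_indic A : measurable A -> Ex \1_A = fine (P A).
Proof. by move=> mA; rewrite /Ex /Rintegral integral_indic// setIT. Qed.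

Lemma EFin_Ex_indic A : measurable A -> (Ex \1_A)%:E = P A.
Proof. by move=> mA; rewrite Ex_indic// fineK// fin_num_measure. Qed.

Lemma ge0_L1 f (c : R) : measurable_fun [set: T] f -> (forall x, 0 <= f x) ->
  (\int[P]_x (f x)%:E)%E = c%:E -> L1 f /\ Ex f = c.
Proof.
move=> mf f0 fc; split; last by rewrite /Ex /Rintegral fc.
apply/integrableP; split; first exact/measurable_EFinP.
by under eq_integral do rewrite /= ger0_norm//; rewrite fc ltry.
Qed.

End expectation_calculus.

(** * Change of variables through a density *)

Section density_transfer.
Local Open Scope ereal_scope.
Context d1 d2 (X : measurableType d1) (Y : measurableType d2) (R : realType).
Variables (mu : {measure set X -> \bar R}) (nu : {measure set Y -> \bar R}).
Variables (phi : X -> Y) (g : X -> R).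
Hypothesis mphi : measurable_fun setT phi.
Hypothesis mg : measurable_fun setT g.
Hypothesis g0 : forall x, (0 <= g x)%R.
Hypothesis nuE : forall A, measurable A ->
  nu A = \int[mu]_x (g x * \1_A (phi x))%:E.

Import HBNNSimple.

(** The measure [nu] is the image under [phi] of the measure with density [g]. It serves twice: with
    [phi] the identity for the normal density, and with [phi] one of the [eps k] and [g] the product
    of the other factors, to split off one independent factor. *)
Lemma ge0_integral_density (f : Y -> R) :
  measurable_fun setT f -> (forall y, (0 <= f y)%R) ->
  \int[nu]_y (f y)%:E = \int[mu]_x (g x * f (phi x))%:E.
Proof.
move=> mf f0.
have mEf : measurable_fun setT (EFin \o f) by exact/measurable_EFinP.
pose f_ := nnsfun_approx measurableT mEf.
have f_cvg y : (f_ n y)%:E @[n --> \oo] --> (f y)%:E.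
  by apply: cvg_nnsfun_approx => // z _; rewrite lee_fin.
have f_nd y m n : (m <= n)%N -> (f_ m y <= f_ n y)%R.
  by move=> mn; exact/lefP/nd_nnsfun_approx.
transitivity (limn (fun n => \int[nu]_y (f_ n y)%:E)).
  rewrite -monotone_convergence//.
  - by apply: eq_integral => y _; apply/esym/cvg_lim => //.
  - by move=> n; exact/measurable_EFinP/measurable_funP.
  - by move=> n y _; rewrite lee_fin.
  - by move=> y _ m n mn; rewrite lee_fin f_nd.
transitivity (limn (fun n => \int[mu]_x (g x * f_ n (phi x))%:E)); last first.
  rewrite -monotone_convergence//.
  - apply: eq_integral => x _; apply/cvg_lim => //.
    rewrite EFinM; under eq_fun do rewrite EFinM.
    exact: cvgeZl.
  - move=> n; apply/measurable_EFinP/measurable_funM => //.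
    by apply: measurableT_comp => //; exact: measurable_funP.
  - by move=> n y _; rewrite lee_fin mulr_ge0.
  - by move=> y _ m n mn; rewrite lee_fin ler_wpM2l// f_nd.
congr (limn _); apply/funext => n.
have mpre r : measurable (f_ n @^-1` [set r]).
  by rewrite -[X in measurable X]setTI; exact: measurable_funP.
transitivity (\sum_(r \in range (f_ n))
    \int[mu]_x (g x * (r * \1_(f_ n @^-1` [set r]) (phi x)))%:E).
  under eq_integral do rewrite fimfunE -fsumEFin//.
  rewrite ge0_integral_fsum//; last 2 first.
  - by move=> y; exact/measurable_EFinP/measurable_funM.
  - by move=> y x _; rewrite nnfun_muleindic_ge0.
  apply: eq_fsbigr => r /set_mem [y _ <-].
  under [in RHS]eq_integral do rewrite mulrCA EFinM.
  rewrite ge0_integralZl_EFin//; last 2 first.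
  - by move=> x _; rewrite lee_fin mulr_ge0.
  - apply/measurable_EFinP/measurable_funM => //.
    by apply: measurableT_comp => //; exact: measurable_indic.
  rewrite integralZl_indic_nnsfun// integral_indic// setIT.
  by rewrite nuE.
rewrite -ge0_integral_fsum//.
- apply: eq_integral => x _; rewrite EFinM [f_ n _ in RHS]fimfunE -fsumEFin//.
  rewrite ge0_mule_fsumr//.
  by move=> r; have := nnfun_muleindic_ge0 (f_ n) r (phi x).
- move=> r; apply/measurable_EFinP/measurable_funM => //.
  apply: measurable_funM => //.
  by apply: measurableT_comp => //; exact: measurable_indic.
- move=> r x _; rewrite EFinM mule_ge0 ?lee_fin//.
  by have := nnfun_muleindic_ge0 (f_ n) r (phi x); rewrite lee_fin.
Qed.

End density_transfer.

(** * The standard normal law *)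

Definition gauss (R : realType) : set R -> \bar R := normal_prob 0 1.

Section gauss_probability.
Variable R : realType.
Local Notation N := (normal_prob (0 : R) 1).

Let gauss0 : gauss (@set0 R) = 0%E.
Proof. exact: (measure0 N). Qed.

Let gauss_ge0 (A : set R) : (0 <= gauss A)%E.
Proof. exact: (measure_ge0 N). Qed.

Let gauss_sigma_additive : semi_sigma_additive (@gauss R).
Proof. exact: (@measure_semi_sigma_additive _ _ _ N). Qed.

HB.instance Definition _ := isMeasure.Build _ R R (@gauss R)
  gauss0 gauss_ge0 gauss_sigma_additive.

Let gauss_setT : gauss [set: R] = 1%E.
Proof. exact: (@probability_setT _ _ _ N). Qed.

HB.instance Definition _ :=
  Measure_isProbability.Build _ R R (@gauss R) gauss_setT.

End gauss_probability.

(** * Expectations of products of independent variables *)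

Section independence.
Context (disp : measure_display) (T : measurableType disp) (R : realType).
Variables (P : probability T R) (eps : nat -> {RV P >-> R}).
Hypothesis heps : iid_standard_normal eps.

Local Notation G := (@gauss R : probability R R).

Let measurable_prod_eps d (f : nat -> R -> R) (Q : pred 'I_d) :
  (forall i, measurable_fun setT (f i)) ->
  measurable_fun setT (fun w => \prod_(i < d | Q i) f i (eps i w)).
Proof.
move=> mf; under [fun _ => _]eq_fun do rewrite big_mkcond.
apply: measurable_prod => i _; case: (Q i) => //.
by apply: measurableT_comp (mf i) _.
Qed.

Let indep_indic d (A : nat -> set R) : (forall i, measurable (A i)) ->
  (\int[P]_w (\prod_(i < d) (\1_(A i) (eps i w) : R))%:E =
   (\prod_(i < d) Ex G \1_(A i))%:E)%E.
Proof.
move=> mA; case: heps => ind law.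
pose J : {fset nat} := [fset i | i in iota 0 d]%fset.
have JE i : (i \in J) = (i < d)%N.
  apply/imfsetP/idP => /= [[j +] ->|id]; first by rewrite mem_iota.
  by exists i => //; rewrite mem_iota.
pose B := \bigcap_(i in [set` J]) (eps i @^-1` A i).
have mpre i : measurable (eps i @^-1` A i).
  by rewrite -[X in measurable X]setTI; exact: measurable_funP.
have mB : measurable B by apply: fin_bigcap_measurable => // i _.
transitivity (\int[P]_w (\1_B w : R)%:E)%E.
  apply: eq_integral => w _; congr EFin; rewrite indicE.
  have [/set_mem wB|/negP wB] := boolP (w \in B).
    apply: big1 => i _; rewrite indicE mem_set//.
    by apply: (wB i); rewrite /= JE.
  apply/eqP/prodf_eq0.
  apply: contrapT => nw; apply: wB; apply/mem_set => i /=.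
  rewrite JE => id; apply: contrapT => nAi; apply: nw.
  by exists (Ordinal id) => //; rewrite indicE memNset.
rewrite integral_indic// setIT [LHS](ind J A mA).
rewrite -prodEFin.
rewrite (perm_big (index_iota 0 d))/=; last first.
  apply: uniq_perm; rewrite ?fset_uniq ?iota_uniq// => i.
  by rewrite JE mem_index_iota.
rewrite big_mkord; apply: eq_bigr => i _.
by rewrite EFin_Ex_indic//; exact: law.
Qed.

Lemma indep_Ex_prod d (f : nat -> R -> R) :
  (forall i, measurable_fun setT (f i)) -> (forall i x, 0 <= f i x) ->
  (forall i, L1 G (f i)) ->
  L1 P (fun w => \prod_(i < d) f i (eps i w)) /\
  Ex P (fun w => \prod_(i < d) f i (eps i w)) = \prod_(i < d) Ex G (f i).
Proof.
move=> mf f0 Lf; apply: ge0_L1.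
- exact: measurable_prod_eps.
- by move=> w; apply: prodr_ge0.
(* Induction on the number of factors that are not indicators. *)
suff H k : forall f : nat -> R -> R,
    (forall i, measurable_fun setT (f i)) -> (forall i x, 0 <= f i x) ->
    (forall i, L1 G (f i)) ->
    (forall i, (k <= i)%N -> exists A, measurable A /\ f i = \1_A) ->
    (\int[P]_w (\prod_(i < d) f i (eps i w))%:E = (\prod_(i < d) Ex G (f i))%:E)%E.
  (* Factors of index at least [d] do not occur in the product; replacing them by the indicator of
     the whole line lets the induction start from [d]. *)
  pose f' i := if (i < d)%N then f i else \1_setT.
  have ff' (i : 'I_d) : f' i = f i by rewrite /f' ltn_ord.
  under [X in X%:E]eq_bigr do rewrite -ff'.
  under eq_integral do under eq_bigr do rewrite -ff'.
  apply: (H d) => i; rewrite /f'; case: ifP => //.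
  - by move=> _; apply: L1_indic.
  - by move=> + di; rewrite ltnNge di.
  - by move=> _ _; exists setT.
elim: k => {f mf f0 Lf} [|k IH] f mf f0 Lf fA.
  have [A hA] := choice (fun i => fA i isT).
  under eq_integral do under eq_bigr do rewrite (hA _).2.
  rewrite indep_indic; last by move=> i; exact: (hA i).1.
  by congr EFin; apply: eq_bigr => i _; rewrite (hA _).2.
have [kd|dk] := ltnP k d; last first.
  pose f' i := if (i < d)%N then f i else \1_setT.
  have ff' (i : 'I_d) : f' i = f i by rewrite /f' ltn_ord.
  under [X in X%:E]eq_bigr do rewrite -ff'.
  under eq_integral do under eq_bigr do rewrite -ff'.
  apply: IH => i; rewrite /f'; case: ifP => //.
  - by move=> _; apply: L1_indic.
  - by move=> id ki; move: (leq_trans dk ki); rewrite leqNgt id.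
  - by move=> _ _; exists setT.
pose ok := Ordinal kd.
pose W w := \prod_(i < d | i != ok) f i (eps i w).
have c0 : 0 <= \prod_(i < d | i != ok) Ex G (f i).
  by apply: prodr_ge0 => i _; exact: Ex_ge0.
rewrite (bigD1 ok)//= mulrC EFinM EFin_Ex//.
under eq_integral do rewrite (bigD1 ok)//= mulrC.
(* The other expectations are absorbed into the measure. [ge0_integral_density] then reduces the
   claim to sets [A], where it is the induction hypothesis with [f k] replaced by the indicator of
   [A]. *)
rewrite -(ge0_integral_mscale _ _ (NngNum c0))//; last 2 first.
  exact/measurable_EFinP.
  by move=> x _; rewrite lee_fin.
symmetry; apply: (@ge0_integral_density _ _ _ _ _ P _ (eps k) W) => //.
- exact: measurable_prod_eps.
- by move=> w; apply: prodr_ge0.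
move=> A mA.
pose fA' i := if i == k then (\1_A : R -> R) else f i.
have fE (i : 'I_d) : i != ok -> fA' i = f i.
  by rewrite /fA' -val_eqE /= => /negbTE ->.
transitivity ((\prod_(i < d | i != ok) Ex G (fA' i))%:E * gauss A)%E.
  by congr (_%:E * _)%E; apply: eq_bigr => i /fE ->.
have -> : gauss A = (Ex G (fA' k))%:E.
  by rewrite /fA' eqxx EFin_Ex_indic.
transitivity ((\prod_(i < d) Ex G (fA' i))%:E).
  by rewrite -EFinM mulrC [in RHS](bigD1 ok).
rewrite -IH.
- apply: eq_integral => w _; rewrite (bigD1 ok)//= mulrC; congr (_ * _)%:E.
    by apply: eq_bigr => i /fE ->.
  by rewrite /fA' eqxx.
- by move=> i; rewrite /fA'; case: eqP.
- by move=> i x; rewrite /fA'; case: eqP.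
- by move=> i; rewrite /fA'; case: eqP => // _; exact: L1_indic.
- move=> i ki; rewrite /fA'; case: eqP => [_|/eqP ik]; first by exists A.
  by apply: fA; rewrite ltn_neqAle eq_sym ik.
Qed.

End independence.

(** * Chebyshev's inequality under a product density *)

(** Writing a single factor as a monomial with exponents 0 and 1 lets the product formula for
    independent variables yield all first and second mixed moments. *)
Lemma prod_expr_eq (R : comPzRingType) d (i : 'I_d) (F : nat -> R) :
  \prod_(k < d) F k ^+ (val k == val i) = F i.
Proof.
rewrite (bigD1 i)//= eqxx expr1 big1 ?mulr1// => k ki.
by rewrite val_eqE (negbTE ki).
Qed.

Section weighted_chebyshev.
Context (disp : measure_display) (T : measurableType disp) (R : realType).
Variables (P : probability T R) (eps : nat -> {RV P >-> R}).
Hypothesis heps : iid_standard_normal eps.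

Local Notation G := (@gauss R : probability R R).

Variables (d : nat) (l Y : nat -> R -> R).
Hypothesis ml : forall i, measurable_fun setT (l i).
Hypothesis mY : forall i, measurable_fun setT (Y i).
Hypothesis l0 : forall i x, 0 <= l i x.
Hypothesis Y0 : forall i x, 0 <= Y i x.
Hypothesis Ll : forall i, L1 G (l i).
Hypothesis LlY2 : forall i, L1 G (fun x => l i x * Y i x ^+ 2).
Hypothesis El1 : forall i, Ex G (l i) = 1.

Let L w := \prod_(i < d) l i (eps i w).
Let S w := \sum_(i < d) Y i (eps i w).
Let m i := Ex G (fun x => l i x * Y i x).
Let M := \sum_(i < d) m i.
Let V := \sum_(i < d) (Ex G (fun x => l i x * Y i x ^+ 2) - m i ^+ 2).

Let LlYe i (e : nat) : (e <= 2)%N -> L1 G (fun x => l i x * Y i x ^+ e).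
Proof.
case: e => [_|[_|[|//]]].
- by under [fun _ => _]eq_fun do rewrite expr0 mulr1.
- apply: (L1_le _ _ (L1D (Ll i) (LlY2 i))).
    by apply: measurable_funM => //; apply: measurable_funX.
  move=> x; rewrite ger0_norm ?mulr_ge0 ?exprn_ge0// -[X in X + _]mulr1 -mulrDr.
  rewrite ler_wpM2l// expr1; have := sqr_ge0 (Y i x - 1); have := Y0 i x; nra.
- by move=> _.
Qed.

Let monomial (e : nat -> nat) : (forall k, (e k <= 2)%N) ->
  L1 P (fun w => L w * \prod_(k < d) Y k (eps k w) ^+ e k) /\
  Ex P (fun w => L w * \prod_(k < d) Y k (eps k w) ^+ e k) =
  \prod_(k < d) Ex G (fun x => l k x * Y k x ^+ e k).
Proof.
move=> e2; under [fun w => _]eq_fun do rewrite -big_split/=.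
apply: (@indep_Ex_prod _ _ _ _ _ heps d (fun k x => l k x * Y k x ^+ e k)).
- by move=> i; apply: measurable_funM => //; apply: measurable_funX.
- by move=> i x; rewrite mulr_ge0// exprn_ge0.
- by move=> i; apply: LlYe.
Qed.

Lemma weight_L1 : L1 P L /\ Ex P L = 1.
Proof.
have [] := @monomial (fun=> 0%N) (fun=> isT).
under [fun w => _]eq_fun do rewrite big1 ?mulr1//.
move=> -> ->; split => //; apply: big1 => k _.
by under [fun w => _]eq_fun do rewrite expr0 mulr1.
Qed.

Let moment1 (i : 'I_d) : L1 P (fun w => L w * Y i (eps i w)) /\
  Ex P (fun w => L w * Y i (eps i w)) = m i.
Proof.
have [|] := @monomial (fun k => (k == val i : nat)); first by move=> k; case: eqP.
under [fun w => _]eq_fun do rewrite (prod_expr_eq i (fun k => Y k (eps k _))).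
move=> -> ->; split => //; rewrite -(prod_expr_eq i m).
apply: eq_bigr => k _; case: eqP => _; rewrite ?expr1 ?expr0.
  by under [fun w => _]eq_fun do rewrite expr1.
by under [fun w => _]eq_fun do rewrite expr0 mulr1.
Qed.

Let moment2 (i j : 'I_d) :
  L1 P (fun w => L w * (Y i (eps i w) * Y j (eps j w))) /\
  Ex P (fun w => L w * (Y i (eps i w) * Y j (eps j w))) =
  m i * m j +
  (if i == j then Ex G (fun x => l i x * Y i x ^+ 2) - m i ^+ 2 else 0).
Proof.
have [|] := @monomial (fun k => (k == val i) + (k == val j))%N.
  by move=> k; case: eqP; case: eqP.
under [fun w => _]eq_fun do under eq_bigr do rewrite exprD.
under [fun w => _]eq_fun do rewrite big_split/=
  (prod_expr_eq i (fun k => Y k (eps k _))) (prod_expr_eq j (fun k => Y k (eps k _))).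
move=> -> ->; split => //; case: eqP => [<-|/eqP ij].
  rewrite -expr2 addrC subrK.
  rewrite -(prod_expr_eq i (fun i => Ex G (fun x => l i x * Y i x ^+ 2))).
  apply: eq_bigr => k _; case: eqP => _; rewrite ?expr1 ?expr0//.
  by under [fun w => _]eq_fun do rewrite expr0 mulr1.
rewrite addr0 -(prod_expr_eq i m) -(prod_expr_eq j m) -big_split/=.
apply: eq_bigr => k _; rewrite -exprD.
have : ((k == val i :> nat) + (k == val j :> nat) < 2)%N.
  case: eqP => [ki|_]; last by case: eqP.
  by case: eqP => // kj; move: ij; rewrite -val_eqE -ki -kj eqxx.
case: (_ + _)%N => [|[|//]] _; rewrite ?expr1 ?expr0.
  by under [fun w => _]eq_fun do rewrite expr0 mulr1.
by under [fun w => _]eq_fun do rewrite expr1.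
Qed.

(** The weight factorizes over the coordinates, so the [eps i] stay independent under the law of
    density [L]: the covariances vanish and the variances add up to [V]. *)
Lemma weighted_variance : L1 P (fun w => L w * (S w - M) ^+ 2) /\
  Ex P (fun w => L w * (S w - M) ^+ 2) = V.
Proof.
have LE : (fun w => L w * (S w - M) ^+ 2) = (fun w =>
    (\sum_(i < d) \sum_(j < d) L w * (Y i (eps i w) * Y j (eps j w)) +
     (- (2 * M)) * \sum_(i < d) L w * Y i (eps i w)) + M ^+ 2 * L w).
  apply/funext => w; under eq_bigr do rewrite -mulr_sumr -mulr_sumr.
  by rewrite -!mulr_sumr -mulr_suml -/(S w); ring.
have L2 : L1 P (fun w => \sum_(i < d) \sum_(j < d) L w * (Y i (eps i w) * Y j (eps j w))).
  by apply: L1_sum => i; apply: L1_sum => j; case: (moment2 i j).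
have LY : L1 P (fun w => \sum_(i < d) L w * Y i (eps i w)).
  by apply: L1_sum => i; case: (moment1 i).
have [LL EL] := weight_L1.
rewrite LE; split.
  by apply: L1D; [apply: L1D => //; exact: L1Zl|exact: L1Zl].
rewrite ExD//; [|by apply: L1D => //; exact: L1Zl|exact: L1Zl].
rewrite ExD//; last exact: L1Zl.
rewrite !ExZl// EL Ex_sum; last first.
  by move=> i; apply: L1_sum => j; case: (moment2 i j).
rewrite Ex_sum; last by move=> i; case: (moment1 i).
rewrite (eq_bigr (fun i : 'I_d => m i * M +
    (Ex G (fun x => l i x * Y i x ^+ 2) - m i ^+ 2))); last first.
  move=> i _; rewrite Ex_sum; last by move=> j; case: (moment2 i j).
  rewrite (eq_bigr _ (fun j _ => (moment2 i j).2)) big_split/= -mulr_sumr.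
  by rewrite -big_mkcond/= [X in _ + X](big_pred1 i)// => j; rewrite eq_sym.
rewrite (eq_bigr _ (fun j _ => (moment1 j).2)) big_split/= -mulr_suml -/M -/V.
by ring.
Qed.

Lemma weighted_chebyshev (t : R) (A : set T) : 0 < t -> measurable A ->
  (forall w, A w -> t <= `|S w - M|) ->
  Ex P (fun w => L w * \1_A w) <= V / t ^+ 2.
Proof.
move=> t0 mA At; have [LV EV] := weighted_variance.
have [LL _] := weight_L1.
have L0 w : 0 <= L w by apply: prodr_ge0.
have LA : L1 P (fun w => L w * \1_A w).
  apply: (L1_le _ _ LL).
    by apply: measurable_funM; [exact: L1_measurable LL|exact: measurable_indic].
  move=> w; rewrite indicE; case: (_ \in _); rewrite ?mulr1 ?mulr0 ?normr0//.
  by rewrite ger0_norm.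
rewrite -EV mulrC -ExZl//; apply: le_Ex => //; first exact: L1Zl.
move=> w; rewrite mulrCA ler_wpM2l// indicE.
case: (boolP (w \in A)) => [/set_mem/At tw|_]; last first.
  by rewrite mulr_ge0 ?sqr_ge0// invr_ge0 sqr_ge0.
rewrite ler_pdivlMl ?exprn_gt0// mulr1 -[leRHS]real_normK ?num_real//.
by apply: lerXn2r tw; rewrite ?nnegrE ?normr_ge0// (ltW t0).
Qed.

End weighted_chebyshev.

(** * Integration against the standard normal law *)

Section gauss_integral_calculus.
Variable R : realType.

Local Notation mu := (@lebesgue_measure R).
Local Notation G := (@gauss R : probability R R).
Local Notation phi := (normal_pdf (0 : R) 1).

Lemma gauss_pdfE (y : R) : phi y = normal_peak 1 * expR (- y ^+ 2 / 2).
Proof.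
rewrite normal_pdfE ?oner_neq0// /normal_fun subr0 expr1n.
by congr (_ * expR (_ / _)); rewrite mulr2n.
Qed.

Let measurable_phi : measurable_fun [set: R] phi.
Proof. exact: measurable_normal_pdf. Qed.

Lemma ge0_integral_gauss (f : R -> R) :
  measurable_fun [set: R] f -> (forall y, 0 <= f y) ->
  (\int[gauss (R:=R)]_y (f y)%:E = \int[mu]_y (phi y * f y)%:E)%E.
Proof.
move=> mf f0.
apply: (@ge0_integral_density _ _ (measurableTypeR R) R _ mu _ id phi) => //.
- by move=> y; exact: normal_pdf_ge0.
- move=> A mA; transitivity (\int[mu]_(y in A) (phi y)%:E)%E => //.
  rewrite [LHS]integral_mkcond.
  apply: eq_integral => y _; rewrite patchE indicE.
  by case: (y \in A); rewrite ?mulr1 ?mulr0.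
Qed.

Let ge0_integral_measure_preserving (tr : measurableTypeR R -> measurableTypeR R)
  (mtr : measurable_fun [set: measurableTypeR R] tr) (g : R -> R) :
  (forall A : set (measurableTypeR R), measurable A -> pushforward mu tr A = mu A) ->
  measurable_fun [set: R] g -> (forall y, 0 <= g y) ->
  (\int[mu]_y (g (tr y))%:E = \int[mu]_y (g y)%:E)%E.
Proof.
move=> trE mg g0; transitivity (\int[pushforward mu tr]_y (g y)%:E)%E.
  rewrite ge0_integral_pushforward//.
  - exact/measurable_EFinP.
  - by move=> y _; rewrite lee_fin.
by apply: eq_measure_integral => A mA _; exact: (trE _ mA).
Qed.

Let ge0_integral_translation (x : R) (g : R -> R) :
  measurable_fun [set: R] g -> (forall y, 0 <= g y) ->
  (\int[mu]_y (g (x + y))%:E = \int[mu]_y (g y)%:E)%E.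
Proof.
pose tr : measurableTypeR R -> measurableTypeR R := +%R x.
have mtr : measurable_fun [set: measurableTypeR R] tr by exact: measurable_funD.
apply: (ge0_integral_measure_preserving mtr) => A mA.
apply/esym/lebesgue_measure_unique => //= _ [[a b]] _ <-.
rewrite /pushforward.
have -> : tr @^-1` `]a, b]%classic = `]a - x, b - x]%classic.
  by apply/seteqP; split=> y /=; rewrite /tr !in_itv/= ltrBlDl lerBrDl.
rewrite !lebesgue_measure_itv/= !lte_fin ltrD2r.
by case: ifP => // _; rewrite -!EFinB; congr EFin; ring.
Qed.

Lemma ge0_gauss_shift (x : R) (f : R -> R) :
  measurable_fun [set: R] f -> (forall y, 0 <= f y) ->
  (\int[gauss (R:=R)]_y (f (x + y))%:E =
   \int[gauss (R:=R)]_y (f y * expR (x * y - x ^+ 2 / 2))%:E)%E.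
Proof.
move=> mf f0; rewrite !ge0_integral_gauss//; last 3 first.
- apply: measurable_funM => //; apply: measurableT_comp => //.
  by apply: measurable_funB => //; apply: measurable_funM.
- by move=> y; rewrite mulr_ge0// expR_ge0.
- by apply: measurableT_comp => //; apply: measurable_funD.
pose g z := phi (z - x) * f z.
transitivity (\int[mu]_y (g (x + y))%:E)%E.
  by apply: eq_integral => y _; rewrite /g addrAC subrr add0r.
transitivity (\int[mu]_y (g y)%:E)%E.
  apply: ge0_integral_translation => [|y]; last by rewrite mulr_ge0// normal_pdf_ge0.
  apply: measurable_funM => //.
  by apply: measurableT_comp => //; apply: measurable_funB.
apply: eq_integral => y _; congr EFin; rewrite /g !gauss_pdfE.
rewrite [f y * _]mulrC mulrA; congr (_ * _).
by rewrite -mulrA -expRD; congr (_ * expR _); field.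
Qed.

Lemma ge0_gauss_opp (f : R -> R) :
  measurable_fun [set: R] f -> (forall y, 0 <= f y) ->
  (\int[gauss (R:=R)]_y (f (- y))%:E = \int[gauss (R:=R)]_y (f y)%:E)%E.
Proof.
move=> mf f0; rewrite !ge0_integral_gauss//; last first.
  by apply: measurableT_comp.
pose g z := phi z * f z.
transitivity (\int[mu]_y (g (- y))%:E)%E.
  by apply: eq_integral => y _; rewrite /g !gauss_pdfE sqrrN.
apply: (@ge0_integral_measure_preserving -%R) => //.
- exact: lebesgue_measureN.
- by apply: measurable_funM.
- by move=> y; rewrite mulr_ge0// normal_pdf_ge0.
Qed.

(** Multiplied by the standard normal density this is a multiple of the normal density of variance
    2. It is the dominating function for all integrands of polynomial or exponential growth
    below. *)
Lemma L1_gauss_expR_sqr : L1 G (fun y => expR (y ^+ 2 / 4)).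
Proof.
have s2 : Num.sqrt 2 != 0 :> R by rewrite gt_eqF// sqrtr_gt0.
pose c : R := normal_peak 1 / normal_peak (Num.sqrt 2).
have c0 : 0 <= c by rewrite divr_ge0// normal_peak_ge0.
have mf : measurable_fun [set: R] (fun y : R => expR (y ^+ 2 / 4)).
  by apply: measurableT_comp => //; apply: measurable_funM => //; apply: measurable_funX.
suff H : (\int[gauss (R:=R)]_y (expR (y ^+ 2 / 4))%:E = c%:E)%E.
  by case: (ge0_L1 mf (fun=> expR_ge0 _) H).
rewrite ge0_integral_gauss//.
transitivity (\int[mu]_y (c * normal_pdf 0 (Num.sqrt 2) y)%:E)%E.
  apply: eq_integral => y _; congr EFin.
  rewrite gauss_pdfE normal_pdfE// /normal_fun subr0 sqr_sqrtr// -mulrA -expRD.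
  rewrite /c -[in RHS]mulrA [in RHS]mulKf ?gt_eqF ?normal_peak_gt0//.
  by congr (_ * expR _); rewrite -mulr_natr; field.
under eq_integral do rewrite EFinM.
rewrite ge0_integralZl_EFin//.
- by rewrite integral_normal_pdf mule1.
- by move=> y _; rewrite lee_fin normal_pdf_ge0.
- by apply/measurable_EFinP; exact: measurable_normal_pdf.
Qed.

Lemma L1_gauss (C : R) (f : R -> R) : measurable_fun [set: R] f ->
  (forall y, `|f y| <= C * expR (y ^+ 2 / 4)) -> L1 G f.
Proof. by move=> mf fC; apply: (L1_le mf fC); exact: L1Zl L1_gauss_expR_sqr. Qed.

(** Raise t <= exp t to the power a/2 at t = y^2/(4a). The rate 1/8 is half of the integrable rate
    1/4, which leaves room for a shift or for a factor [expR (b * |y|)]. *)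
Lemma normr_powR_le_expR (a : R) : 0 < a ->
  exists2 C, 0 < C & forall y : R, `|y| `^ a <= C * expR (y ^+ 2 / 8).
Proof.
move=> a0; pose b := a / 2; have b0 : 0 < b by rewrite divr_gt0.
exists ((8 * b) `^ b); first by rewrite powR_gt0// mulr_gt0.
move=> y; have -> : a = 2%:R * b by rewrite /b; field.
rewrite powRrM powR_mulrn// real_normK ?num_real//.
have -> : y ^+ 2 = (8 * b) * (y ^+ 2 / 8 / b).
  by field; rewrite gt_eqF.
have y0 : 0 <= y ^+ 2 / 8 / b by rewrite !divr_ge0 ?sqr_ge0 ?ltW.
have b8 : 0 <= 8 * b by rewrite mulr_ge0 ?ltW.
rewrite powRM// ler_wpM2l ?powR_ge0//.
have -> : 8 * b * (y ^+ 2 / 8 / b) / 8 = (y ^+ 2 / 8 / b) * b.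
  by field; rewrite gt_eqF.
rewrite expRM ge0_ler_powR ?nnegrE ?expR_ge0 ?(ltW b0)//.
by rewrite (le_trans _ (expR_ge1Dx _))// lerDr.
Qed.

Lemma measurable_normr_powR (a x : R) :
  measurable_fun [set: R] (fun y : R => `|x + y| `^ a).
Proof.
apply: (measurableT_comp (measurable_powR _)).
by apply: measurableT_comp => //; apply: measurable_funD.
Qed.

Lemma L1_shift_powR (a x : R) : 0 < a -> L1 G (fun y => `|x + y| `^ a).
Proof.
move=> a0; have [C C0 HC] := normr_powR_le_expR a0.
apply: (@L1_gauss (C * expR (x ^+ 2 / 4))); first exact: measurable_normr_powR.
move=> y; rewrite ger0_norm ?powR_ge0// (le_trans (HC _))// -[leRHS]mulrA.
rewrite ler_wpM2l ?(ltW C0)// -expRD ler_expR.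
have := sqr_ge0 (x - y); nra.
Qed.

Lemma L1_powR_expR (a b : R) : 0 < a ->
  L1 G (fun y => `|y| `^ a * expR (b * `|y|)).
Proof.
move=> a0; have [C C0 HC] := normr_powR_le_expR a0.
apply: (@L1_gauss (C * expR (2 * b ^+ 2))).
  apply: measurable_funM.
    by apply: (measurableT_comp (measurable_powR _)).
  by apply: measurableT_comp => //; apply: measurable_funM.
move=> y; rewrite ger0_norm ?mulr_ge0 ?powR_ge0 ?expR_ge0//.
rewrite (le_trans (ler_wpM2r (expR_ge0 _) (HC _)))//.
rewrite -[leLHS]mulrA -[leRHS]mulrA ler_wpM2l ?(ltW C0)// -!expRD ler_expR.
have := sqr_ge0 (4 * b - `|y|); rewrite sqrrB real_normK ?num_real//; nra.
Qed.

Lemma L1_expR (b : R) : L1 G (fun y => expR (b * `|y|)).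
Proof.
apply: (@L1_gauss (expR (b ^+ 2))).
  by apply: measurableT_comp => //; apply: measurable_funM.
move=> y; rewrite ger0_norm ?expR_ge0// -expRD ler_expR.
have := sqr_ge0 (2 * b - `|y|); rewrite sqrrB real_normK ?num_real//; nra.
Qed.

(** This is exp(-x^2/2) cosh(xy), the density with respect to the standard normal law of the equal
    mixture of the unit-variance normal laws with means x and -x. *)
Definition tilt (x y : R) : R :=
  expR (- (x ^+ 2 / 2)) * ((expR (x * y) + expR (- (x * y))) / 2).

Lemma measurable_tilt (x : R) : measurable_fun [set: R] (tilt x).
Proof.
apply: measurable_funM => //; apply: measurable_funM => //.
have mxy : measurable_fun [set: R] ( *%R x) by exact: measurable_funM.
by apply: measurable_funD; do ?apply: measurableT_comp => //.
Qed.

Lemma tilt_ge0 x y : 0 <= tilt x y.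
Proof. by rewrite mulr_ge0 ?expR_ge0// divr_ge0// addr_ge0// expR_ge0. Qed.

Lemma tilt_le x y : tilt x y <= expR (`|x| * `|y|).
Proof.
have xy : `|x * y| = `|x| * `|y| by rewrite normrM.
rewrite -[leRHS]mul1r ler_pM ?expR_ge0//.
- by rewrite -expR0 ler_expR oppr_le0 divr_ge0// sqr_ge0.
rewrite ler_pdivrMr// mulr_natr mulr2n lerD// ler_expR -xy ?ler_norm//.
by rewrite -normrN ler_norm.
Qed.

(* Cameron-Martin; evenness symmetrizes the density [expR (x * y - x ^+ 2 / 2)]
   into [tilt x y]. *)
Lemma gauss_shift_even (x : R) (f : R -> R) : measurable_fun [set: R] f ->
  (forall y, 0 <= f y) -> (forall y, f (- y) = f y) ->
  L1 G (fun y => f y * expR (`|x| * `|y|)) ->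
  L1 G (fun y => f y * tilt x y) /\
  Ex G (fun y => f (x + y)) = Ex G (fun y => f y * tilt x y).
Proof.
move=> mf f0 fN Lf.
have mxy : measurable_fun [set: R] (fun y => f y * expR (x * y - x ^+ 2 / 2)).
  apply: measurable_funM => //; apply: measurableT_comp => //.
  by apply: measurable_funB => //; apply: measurable_funM.
have Lt : L1 G (fun y => f y * tilt x y).
  apply: (L1_le _ _ Lf).
    by apply: measurable_funM => //; exact: measurable_tilt.
  move=> y; rewrite ger0_norm ?mulr_ge0 ?tilt_ge0//.
  by rewrite ler_wpM2l ?tilt_le.
split => //.
have h1 := ge0_gauss_shift x mf f0.
have h2 := ge0_gauss_opp mxy (fun y => mulr_ge0 (f0 y) (expR_ge0 _)).
have Lxy : L1 G (fun y => f y * expR (x * y - x ^+ 2 / 2)).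
  apply: (L1_le _ _ Lf) => //.
  move=> y; rewrite ger0_norm ?mulr_ge0 ?expR_ge0//.
  rewrite ler_wpM2l// ler_expR -normrM.
  by rewrite lerBlDr ler_wpDr ?divr_ge0 ?sqr_ge0// ler_norm.
have Lyx : L1 G (fun y => f y * expR (- (x * y) - x ^+ 2 / 2)).
  apply: (L1_le _ _ Lf) => //.
    apply: measurable_funM => //; apply: measurableT_comp => //.
    apply: measurable_funB => //.
    by apply: measurableT_comp => //; apply: measurable_funM.
  move=> y; rewrite ger0_norm ?mulr_ge0 ?expR_ge0//.
  rewrite ler_wpM2l// ler_expR -normrM.
  by rewrite lerBlDr ler_wpDr ?divr_ge0 ?sqr_ge0// -normrN ler_norm.
have E1 : Ex G (fun y => f (x + y)) = Ex G (fun y => f y * expR (x * y - x ^+ 2 / 2)).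
  by rewrite /Ex /Rintegral h1.
have E2 : Ex G (fun y => f y * expR (- (x * y) - x ^+ 2 / 2)) =
          Ex G (fun y => f y * expR (x * y - x ^+ 2 / 2)).
  rewrite [RHS]/Ex /Rintegral -h2; congr fine; apply: eq_integral => y _.
  by rewrite fN mulrN.
transitivity (Ex G (fun y => 2^-1 * (f y * expR (x * y - x ^+ 2 / 2) +
    f y * expR (- (x * y) - x ^+ 2 / 2)))).
  by rewrite ExZl ?ExD//; [rewrite E2 E1; by field|exact: L1D].
by apply: eq_Rintegral => y _; rewrite /tilt !expRD; field.
Qed.

Lemma Ex_tilt x : L1 G (tilt x) /\ Ex G (tilt x) = 1.
Proof.
have [] := @gauss_shift_even x (fun=> 1) => //.
  by under [fun _ => _]eq_fun do rewrite mul1r; exact: L1_expR.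
under [fun _ => _]eq_fun do rewrite mul1r.
move=> Lt <-; split => //; exact: Ex_cst.
Qed.

Definition absmom (a x : R) := Ex G (fun y => `|x + y| `^ a).

(* The expected increase of the [a]-th power of one coordinate caused by the
   shift [x]: of order x^2 near 0 and of order |x|^a at infinity. *)
Definition excess (a x : R) := absmom a x - absmom a 0.

Lemma excessE (a x : R) : 0 < a ->
  L1 G (fun y => `|y| `^ a * tilt x y) /\
  excess a x = Ex G (fun y => `|y| `^ a * (tilt x y - 1)).
Proof.
move=> a0; have [] := @gauss_shift_even x (fun y => `|y| `^ a) => //.
- exact: (measurableT_comp (measurable_powR _)).
- by move=> y; rewrite normrN.
- exact: L1_powR_expR.
move=> Lt Et; split => //; rewrite /excess /absmom Et.
have Ly : L1 G (fun y => `|y| `^ a).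
  by have := @L1_shift_powR a 0 a0; under [fun _ => _]eq_fun do rewrite add0r.
have -> : (fun y : R => `|0 + y| `^ a) = (fun y => `|y| `^ a).
  by apply/funext => y; rewrite add0r.
by rewrite -(ExB Lt Ly); apply: eq_Rintegral => y _; rewrite mulrBr mulr1.
Qed.

End gauss_integral_calculus.

(** * Inequalities between real numbers *)

Section real_inequalities.
Variable R : realType.
Implicit Types a x y : R.

(** With v = u/2, the difference exp(u) + exp(-u) - 2 is the square of exp(v) - exp(-v), which is at
    least v for v >= 0. The upper bound [cosh_le] uses the same square. *)
Lemma cosh_ge u : 2 + u ^+ 2 / 4 <= expR u + expR (- u) :> R.
Proof.
wlog u0 : u / 0 <= u => [H|].
  have [/H//|/ltW u0] := leP 0 u.
  by have := H (- u); rewrite oppr_ge0 sqrrN opprK => /(_ u0); rewrite [leRHS]addrC.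
pose v := u / 2; have v0 : 0 <= v by rewrite divr_ge0.
have ev : expR v * expR (- v) = 1 by rewrite -expRD subrr expR0.
have -> : expR u = expR v ^+ 2 by rewrite expr2 -expRD; congr expR; rewrite /v; field.
have -> : expR (- u) = expR (- v) ^+ 2.
  by rewrite expr2 -expRD; congr expR; rewrite /v; field.
have -> : u ^+ 2 / 4 = v ^+ 2 by rewrite /v; field.
have v1 := expR_ge1Dx v; have e0 := expR_ge0 (- v).
have : v <= expR v - expR (- v) by nra.
nra.
Qed.

Lemma cosh_le u : expR u + expR (- u) <= 2 + u ^+ 2 * expR `|u| :> R.
Proof.
wlog u0 : u / 0 <= u => [H|].
  have [/H//|/ltW u0] := leP 0 u.
  by have := H (- u); rewrite oppr_ge0 sqrrN opprK normrN => /(_ u0); rewrite [leLHS]addrC.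
rewrite (ger0_norm u0).
pose v := u / 2; have v0 : 0 <= v by rewrite divr_ge0.
have ev : expR v * expR (- v) = 1 by rewrite -expRD subrr expR0.
have -> : expR u = expR v ^+ 2 by rewrite expr2 -expRD; congr expR; rewrite /v; field.
have -> : expR (- u) = expR (- v) ^+ 2.
  by rewrite expr2 -expRD; congr expR; rewrite /v; field.
have -> : u ^+ 2 = 4 * v ^+ 2 by rewrite /v; field.
have e1 : 1 - 2 * v <= expR (- v) ^+ 2.
  have -> : expR (- v) ^+ 2 = expR (- (2 * v)).
    by rewrite expr2 -expRD; congr expR; ring.
  exact: expR_ge1Dx.
have e0 := expR_gt0 v.
have e2 : 0 <= expR v - expR (- v).
  by rewrite subr_ge0 ler_expR ge0_cp.
have e3 : expR v - expR (- v) <= 2 * v * expR v.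
  have : 0 <= expR v * (expR (- v) ^+ 2 - (1 - 2 * v)).
    by rewrite mulr_ge0 ?subr_ge0// ltW.
  rewrite mulrBr expr2 mulrA ev; nra.
have : (expR v - expR (- v)) ^+ 2 <= (2 * v * expR v) ^+ 2.
  by apply: lerXn2r e3; rewrite nnegrE// !mulr_ge0// ltW.
nra.
Qed.

Lemma cosh_mono u v : `|u| <= `|v| :> R ->
  expR u + expR (- u) <= expR v + expR (- v).
Proof.
have E w : expR w + expR (- w) = expR `|w| + expR (- `|w|) :> R.
  by have [w0|w0] := ger0P w; rewrite ?opprK// addrC.
rewrite (E u) (E v); move: (normr_ge0 u) (normr_ge0 v).
move: `|u| `|v| => {}u {}v u0 v0 uv.
have eu : expR u * expR (- u) = 1 by rewrite -expRD subrr expR0.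
have ev : expR v * expR (- v) = 1 by rewrite -expRD subrr expR0.
have h1 : 0 <= expR v - expR u by rewrite subr_ge0 ler_expR.
have h2 : expR (- u) * expR (- v) <= 1.
  by rewrite -expRD -expR0 ler_expR; lra.
have : expR (- u) - expR (- v) = (expR v - expR u) * (expR (- u) * expR (- v)).
  rewrite mulrBl mulrCA ev mulr1 mulrA eu mul1r; ring.
nra.
Qed.

Lemma powR_normD_le a x y : 0 < a ->
  `|x + y| `^ a <= 2 `^ a * (`|x| `^ a + `|y| `^ a).
Proof.
move=> a0.
have H (u v : R) : 0 <= u -> u <= v -> (u + v) `^ a <= 2 `^ a * v `^ a.
  move=> u0 uv; have v0 := le_trans u0 uv.
  rewrite -powRM// ge0_ler_powR ?nnegrE ?(ltW a0) ?mulr_ge0 ?addr_ge0//; lra.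
apply: (@le_trans _ _ ((`|x| + `|y|) `^ a)).
  by rewrite ge0_ler_powR ?nnegrE ?(ltW a0) ?addr_ge0// ler_normD.
have [xy|/ltW yx] := leP `|x| `|y|.
  by apply: (le_trans (H _ _ _ xy)) => //; rewrite ler_wpM2l ?powR_ge0// lerDr powR_ge0.
rewrite addrC; apply: (le_trans (H _ _ _ yx)) => //.
by rewrite ler_wpM2l ?powR_ge0// lerDl powR_ge0.
Qed.

(** Two regimes. If |y| <= t|x|, homogeneity reduces the claim to continuity of u^a at 1, which
    provides t; otherwise |x| < |y|/t and both powers are absorbed by a multiple of |y|^a. *)
Lemma powR_norm_perturb a e : 0 < a -> 0 < e -> exists2 C, 0 <= C &
  forall x y, `| `|x + y| `^ a - `|x| `^ a| <= e * `|x| `^ a + C * `|y| `^ a.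
Proof.
move=> a0 e0.
have cont1 : {for 1, continuous (fun u : R => u `^ a)}.
  apply/differentiable_continuous/derivable1_diffP; apply: derivable_powR.
  by rewrite in_itv/= ltr01.
have p1 : (1 : R) `^ a = 1 by rewrite powR1.
have [t t01 tP] : exists2 t, 0 < t < 1 &
    forall u, `|u - 1| <= t -> `|u `^ a - 1| <= e.
  have := cont1 => /cvgrPdist_le /(_ _ e0).
  move=> [r /= r0 rP]; exists (Num.min (r / 2) (1 / 2)).
    by rewrite lt_min gt_min; apply/andP; split; [apply/andP; split; lra|apply/orP; right; lra].
  move=> u; rewrite le_min => /andP[ur _]; rewrite distrC -[X in `|X - _|]p1; apply: rP => /=.
  by rewrite distrC; apply: le_lt_trans ur _; lra.
have [t0 t1] := andP t01.
exists ((1 + t^-1) `^ a); first exact: powR_ge0.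
move=> x y; have [yx|xy] := leP `|y| (t * `|x|).
  have [->|x0] := eqVneq x 0.
    rewrite normr0 add0r powR0 ?gt_eqF// subr0 mulr0 add0r ger0_norm ?powR_ge0//.
    rewrite ler_peMl ?powR_ge0//.
    rewrite -[leLHS]p1; apply: ge0_ler_powR; rewrite ?nnegrE ?(ltW a0)//.
      by rewrite addr_ge0// invr_ge0 ltW.
    by rewrite lerDl invr_ge0 ltW.
  have nx : 0 < `|x| by rewrite normr_gt0.
  have -> : `|x + y| = (`|x + y| / `|x|) * `|x| by rewrite divfK ?gt_eqF.
  rewrite powRM ?divr_ge0// -[X in `|_ - X|]mul1r -mulrBl normrM.
  rewrite (ger0_norm (powR_ge0 _ _)) ler_wpDr ?mulr_ge0 ?powR_ge0//.
  rewrite ler_wpM2r ?powR_ge0// tP//.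
  rewrite -[X in `|_ - X|](divff (lt0r_neq0 nx)) -mulrBl normrM normfV normr_id.
  rewrite ler_pdivrMr// (le_trans _ yx)//.
  by rewrite (le_trans (ler_dist_dist _ _))// addrAC subrr add0r.
have xt : `|x| <= t^-1 * `|y| by rewrite ler_pdivlMl// ltW.
rewrite ler_wpDl ?mulr_ge0 ?powR_ge0 ?(ltW e0)//.
have c0 : 0 <= 1 + t^-1 by rewrite addr_ge0// invr_ge0 ltW.
have t'0 : 0 <= t^-1 by rewrite invr_ge0 ltW.
have H1 : `|x + y| `^ a <= (1 + t^-1) `^ a * `|y| `^ a.
  rewrite -powRM// ge0_ler_powR ?nnegrE ?(ltW a0) ?mulr_ge0//.
  rewrite (le_trans (ler_normD _ _))// mulrDl mul1r addrC lerD2l//.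
have H2 : `|x| `^ a <= (1 + t^-1) `^ a * `|y| `^ a.
  rewrite -powRM// ge0_ler_powR ?nnegrE ?(ltW a0) ?mulr_ge0//.
  by rewrite (le_trans xt)// ler_wpM2r// lerDr.
have := powR_ge0 `|x + y| a; have := powR_ge0 `|x| a.
by rewrite ler_norml; lra.
Qed.

Lemma powR_superadd a x y : 1 <= a -> 0 <= x -> 0 <= y ->
  x `^ a + y `^ a <= (x + y) `^ a.
Proof.
move=> a1 x0 y0.
have a0 : a != 0 by rewrite gt_eqF// (lt_le_trans _ a1).
have [->|xn0] := eqVneq x 0; first by rewrite powR0// !add0r.
have s0 : 0 < x + y by rewrite ltr_wpDr// lt_def xn0.
have H (z : R) : 0 <= z -> z <= x + y -> z `^ a <= (z / (x + y)) * (x + y) `^ a.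
  move=> z0 zs; have [->|zn0] := eqVneq z 0; first by rewrite powR0// !mul0r.
  have -> : z `^ a = (z / (x + y)) `^ a * (x + y) `^ a.
    by rewrite -powRM ?divr_ge0 ?(ltW s0)// divfK ?gt_eqF.
  rewrite ler_wpM2r ?powR_ge0// ge1r_powR//.
  by rewrite divr_gt0//= ?ler_pdivrMr ?mul1r// lt_def zn0.
apply: (le_trans (lerD (H x x0 _) (H y y0 _))); rewrite ?lerDl ?lerDr//.
by rewrite -mulrDl -mulrDl divff ?mul1r// gt_eqF.
Qed.

(** Clarkson's inequality on the line. With s = a/2, superadditivity of u^s passes to (x^2 + y^2)^s;
    then x^2 + y^2 is the mean of (x+y)^2 and (x-y)^2, and u^s is convex. *)
Lemma powR_norm_clarkson a x y : 2 <= a ->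
  2 * (`|x| `^ a + `|y| `^ a) <= `|x + y| `^ a + `|x - y| `^ a.
Proof.
move=> a2; pose s := a / 2; have s1 : 1 <= s by rewrite /s; lra.
have E (z : R) : `|z| `^ a = (z ^+ 2) `^ s.
  rewrite -real_normK ?num_real// -powR_mulrn// -powRrM; congr (_ `^ _).
  by rewrite /s; field.
rewrite !E.
apply: (@le_trans _ _ (2 * (x ^+ 2 + y ^+ 2) `^ s)).
  by rewrite ler_wpM2l// powR_superadd ?sqr_ge0.
have -> : x ^+ 2 + y ^+ 2 = 2^-1 * (x + y) ^+ 2 + 2^-1 * (x - y) ^+ 2 by field.
rewrite -ler_pdivlMl// mulrDr.
rewrite {2 4}(_ : 2^-1 = 1 - 2^-1); last by field.
by apply: (convex_powR s1 (Itv01 _ _)) => //=;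
  rewrite ?inE/= ?in_itv/= ?sqr_ge0// ?invr_ge0// invf_le1 ?ler1n.
Qed.

End real_inequalities.

(** * Moments of a shifted normal variable *)

Section excess_moments.
Variable R : realType.

Local Notation G := (@gauss R : probability R R).
Local Notation phi := (normal_pdf (0 : R) 1).

Lemma gauss_itv_ge (B s t : R) : s <= t -> `|s| <= B -> `|t| <= B ->
  (t - s) * phi B <= Ex G (\1_`[s, t]).
Proof.
move=> st sB tB; rewrite -lee_fin EFin_Ex_indic//.
change ((((t - s) * phi B)%:E <= \int[lebesgue_measure]_(y in `[s, t]) (phi y)%:E)%E).
apply: (@le_trans _ _ (\int[lebesgue_measure]_(y in `[s, t]) (phi B)%:E)%E).
  rewrite integral_cst//= lebesgue_measure_itv/= lte_fin.
  case: ltP => [_|ts]; first by rewrite -EFinB -EFinM mulrC.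
  have -> : t = s by apply/eqP; rewrite eq_le ts st.
  by rewrite subrr mul0r mule0.
apply: ge0_le_integral => //.
- by move=> y _; rewrite lee_fin normal_pdf_ge0.
- by apply/measurable_EFinP/measurable_funTS; exact: measurable_normal_pdf.
move=> y; rewrite /= in_itv/= => /andP[sy yt]; rewrite lee_fin !gauss_pdfE.
rewrite ler_wpM2l ?normal_peak_ge0// ler_expR ler_pM2r// lerN2.
move: sB tB; rewrite !ler_norml => /andP[s1 s2] /andP[t1 t2]; nra.
Qed.

Lemma gauss_pdf_gt0 (B : R) : 0 < phi B.
Proof. by rewrite gauss_pdfE mulr_gt0 ?expR_gt0// normal_peak_gt0 ?oner_neq0. Qed.

Lemma L1_normr_powR (a : R) : 0 < a -> L1 G (fun y => `|y| `^ a).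
Proof.
move=> a0; have := @L1_shift_powR R a 0 a0.
by under [fun _ => _]eq_fun do rewrite add0r.
Qed.

Lemma powR_sqr (a z : R) : 0 <= z -> (z `^ a) ^+ 2 = z `^ (a * 2).
Proof. by move=> z0; rewrite powRrM powR_mulrn// powR_ge0. Qed.

Lemma L1_shift_powR_sqr (a x : R) : 0 < a ->
  L1 G (fun y => (`|x + y| `^ a) ^+ 2).
Proof.
move=> a0; under [fun _ => _]eq_fun do rewrite powR_sqr//.
by apply: L1_shift_powR; rewrite mulr_gt0.
Qed.

Lemma absmom_ge0 (a x : R) : 0 <= absmom a x.
Proof. by apply: Ex_ge0 => y; exact: powR_ge0. Qed.

Lemma absmomE (a x : R) : absmom a x = absmom a 0 + excess a x.
Proof. by rewrite /excess addrC subrK. Qed.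

Lemma continuous_tilt (x : R) : continuous (tilt x).
Proof.
have ce (b : R) : continuous (fun y : R => expR (b * y)).
  move=> y; apply: continuous_comp; first exact: mulrl_continuous.
  exact: continuous_expR.
have -> : tilt x = (fun y => expR (- (x ^+ 2 / 2)) * ((expR (x * y) + expR ((- x) * y)) / 2)).
  by apply/funext => y; rewrite /tilt mulNr.
move=> y; apply: cvgM; first exact: cvg_cst.
apply: cvgM; last exact: cvg_cst.
by apply: cvgD; exact: ce.
Qed.

Lemma tilt_mono (x y z : R) : `|y| <= `|z| -> tilt x y <= tilt x z.
Proof.
move=> yz; rewrite ler_wpM2l ?expR_ge0// ler_pM2r// cosh_mono//.
by rewrite !normrM ler_wpM2l.
Qed.

(* [tilt x - 1] integrates to 0 and increases with |y|; subtracting from |y|^a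
   its value at the sign change makes the integrand nonnegative. *)
Lemma excess_ge_sqr (a M : R) : 0 < a -> 0 < M ->
  exists2 c, 0 < c & forall x, `|x| <= M -> c * x ^+ 2 <= excess a x.
Proof.
(* With s = x^2/2 one has exp(s) <= 1 + sK, and [cosh_ge] then gives [tilt x (2 * r) >= 1]: the sign
   change lies in [0, 2r] for every |x| <= M. On [A], which starts at 3r, the same bound leaves tilt
   - 1 >= (9/8 - 4/8) x^2. *)
move=> a0 M0; pose K := expR (M ^+ 2 / 2); pose r := Num.sqrt K.
have K0 : 0 < K by exact: expR_gt0.
have r0 : 0 < r by rewrite sqrtr_gt0.
have rK : r ^+ 2 = K by rewrite sqr_sqrtr// ltW.
pose A : set R := `[3 * r, 3 * r + 1]%classic.
have A0 : 0 < Ex G (\1_A).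
  apply: lt_le_trans (@gauss_itv_ge (3 * r + 1) _ _ _ _ _); last 3 first.
  - by rewrite lerDl.
  - by rewrite ger0_norm; nra.
  - by rewrite ger0_norm; nra.
  by rewrite mulr_gt0 ?gauss_pdf_gt0// addrAC subrr add0r.
pose d := (3 * r) `^ a - (2 * r) `^ a.
have d0 : 0 < d.
  by rewrite subr_gt0 gt0_ltr_powR ?nnegrE//; nra.
exists (d * (5 / 8) * Ex G (\1_A)); first by rewrite !mulr_gt0//.
move=> x xM.
have x2 : x ^+ 2 <= M ^+ 2.
  by rewrite -real_normK ?num_real// lerXn2r ?nnegrE// ltW.
pose s := x ^+ 2 / 2; have s0 : 0 <= s by rewrite divr_ge0// sqr_ge0.
have es : expR s * expR (- s) = 1 by rewrite -expRD subrr expR0.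
have esK : expR s <= K by rewrite ler_expR ler_pM2r.
have es0 := expR_gt0 s; have ens0 := expR_gt0 (- s).
have es1 : expR s <= 1 + s * K.
  have h := expR_ge1Dx (- s).
  have : expR s * (1 - s) <= 1 by rewrite -[leRHS]es ler_wpM2l.
  nra.
have tilt_ge y : expR (- s) * (1 + x ^+ 2 * y ^+ 2 / 8) <= tilt x y.
  rewrite /tilt ler_wpM2l ?(ltW ens0)//.
  by have := cosh_ge (x * y); rewrite exprMn; lra.
have [y0 y0r y0E] : exists2 y0, 0 <= y0 <= 2 * r & tilt x y0 = 1.
  have [|||y0] := @IVT R (tilt x) 0 (2 * r) 1.
  - by rewrite mulr_ge0// ltW.
  - exact/continuous_subspaceT/continuous_tilt.
  - rewrite ge_min le_max; apply/andP; split; apply/orP; [left|right].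
      rewrite /tilt mulr0 oppr0 expR0 -[leRHS](@expR0 R).
      by rewrite (_ : (1 + 1) / 2 = 1) ?mulr1 ?ler_expR ?oppr_le0//; field.
    apply: le_trans (tilt_ge (2 * r)).
    rewrite -[leLHS]es mulrC ler_wpM2l ?(ltW ens0)// (le_trans es1)//.
    by rewrite /s exprMn rK; nra.
  - by rewrite in_itv/= => y0r y0E; exists y0.
have [y00 y02] := andP y0r.
pose b := y0 `^ a.
have b2 : b <= (2 * r) `^ a by rewrite ge0_ler_powR ?nnegrE ?(ltW a0)// mulr_ge0 ?ltW.
have [Lt Et] := Ex_tilt x.
have [Lat ->] := excessE x a0.
have La := L1_normr_powR a0.
pose g y := `|y| `^ a * (tilt x y - 1) - b * (tilt x y - 1).
have Lg1 : L1 G (fun y => `|y| `^ a * (tilt x y - 1)).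
  under [fun _ => _]eq_fun do rewrite mulrBr mulr1.
  exact: L1B.
have Lt1 : L1 G (fun y => tilt x y - 1) by apply: L1B => //; exact: L1_cst.
have Lg2 : L1 G (fun y => b * (tilt x y - 1)) by exact: L1Zl.
have Eg : Ex G g = Ex G (fun y => `|y| `^ a * (tilt x y - 1)).
  rewrite (ExB Lg1 Lg2) (ExZl _ Lt1) (ExB Lt (L1_cst _ _)) Et Ex_cst subrr.
  by rewrite mulr0 subr0.
rewrite -Eg.
have LA : L1 G (\1_A : R -> R) by apply: L1_indic; exact: measurable_itv.
rewrite mulrAC -(ExZl _ LA).
apply: le_Ex; [exact: L1Zl|exact: L1B|move=> y].
rewrite /g -mulrBl.
have pos : 0 <= (`|y| `^ a - b) * (tilt x y - 1).
  have [yy|yy] := leP y0 `|y|.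
    rewrite mulr_ge0// subr_ge0.
      by rewrite ge0_ler_powR ?nnegrE ?(ltW a0).
    by rewrite -y0E tilt_mono// ger0_norm.
  rewrite mulr_le0// subr_le0.
    by rewrite ge0_ler_powR ?nnegrE ?(ltW a0) ?(ltW yy).
  by rewrite -y0E tilt_mono// (ger0_norm y00) ltW.
rewrite indicE; case: (boolP (y \in A)) => [/set_mem yA|_]; last by rewrite mulr0.
move: yA; rewrite /A/= in_itv/= => /andP[ry _].
have y3 : 0 <= y by apply: le_trans ry; rewrite mulr_ge0// ltW.
rewrite mulr1 -mulrA; apply: ler_pM; rewrite ?(ltW d0)//.
- by rewrite mulr_ge0 ?sqr_ge0.
- rewrite /d lerB// ge0_ler_powR ?nnegrE ?(ltW a0) ?normr_ge0//.
    by rewrite mulr_ge0// ltW.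
  by rewrite ger0_norm.
- have yK : 9 * K <= y ^+ 2 by rewrite -rK; nra.
  rewrite lerBrDr (le_trans _ (tilt_ge y))//.
  have x20 := sqr_ge0 x.
  have h1 : expR (- s) * (1 + x ^+ 2 * (9 * K) / 8) <= expR (- s) * (1 + x ^+ 2 * y ^+ 2 / 8).
    by rewrite ler_wpM2l ?(ltW ens0)// lerD2l ler_pM2r// ler_wpM2l.
  apply: le_trans h1.
  have h2 : 1 <= expR (- s) * (1 + s * K).
    by rewrite -[leLHS]es mulrC ler_wpM2l.
  have h3 : 1 <= K * expR (- s) by rewrite -[leLHS]es ler_wpM2r.
  have -> : expR (- s) * (1 + x ^+ 2 * (9 * K) / 8) =
    expR (- s) * (1 + s * K) + 5 / 8 * x ^+ 2 * (K * expR (- s)) by rewrite /s; field.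
  by rewrite addrC lerD// -[leLHS]mulr1 ler_wpM2l// mulr_ge0.
Qed.

Lemma excess_le_sqr (a M : R) : 0 < a -> 0 <= M ->
  exists2 C, 0 <= C & forall x, `|x| <= M -> excess a x <= C * x ^+ 2.
Proof.
move=> a0 M0; pose g (y : R) := `|y| `^ (a + 2) * expR (M * `|y|).
have Lg : L1 G g by apply: L1_powR_expR; rewrite addr_gt0.
exists (Ex G g / 2).
  by rewrite divr_ge0// Ex_ge0// => y; rewrite mulr_ge0 ?powR_ge0 ?expR_ge0.
move=> x xM; have [Lat ->] := excessE x a0.
rewrite mulrAC -mulrA mulrC -(ExZl _ Lg); apply: le_Ex.
- under [fun _ => _]eq_fun do rewrite mulrBr mulr1.
  by apply: L1B => //; exact: L1_normr_powR.
- exact: L1Zl.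
move=> y; rewrite /g powRD; last by rewrite gt_eqF// addr_gt0.
rewrite powR_mulrn// real_normK ?num_real//.
have -> : x ^+ 2 / 2 * (`|y| `^ a * y ^+ 2 * expR (M * `|y|)) =
   `|y| `^ a * ((x * y) ^+ 2 * expR (M * `|y|) / 2) by rewrite exprMn; field.
rewrite ler_wpM2l ?powR_ge0//.
have h := cosh_le (x * y).
have h2 : expR `|x * y| <= expR (M * `|y|) by rewrite ler_expR normrM ler_wpM2r.
have h3 : tilt x y <= (expR (x * y) + expR (- (x * y))) / 2.
  rewrite /tilt ler_piMl ?divr_ge0 ?addr_ge0 ?expR_ge0//.
  by rewrite -[leRHS](@expR0 R) ler_expR oppr_le0 divr_ge0// sqr_ge0.
have := ler_wpM2l (sqr_ge0 (x * y)) h2.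
lra.
Qed.

Lemma normr_powR_le_excess (a x : R) : 0 < a ->
  `|x| `^ a <= 2 `^ a * (excess a x + 2 * absmom a 0).
Proof.
move=> a0.
have -> : excess a x + 2 * absmom a 0 = absmom a x + absmom a 0.
  by rewrite (absmomE a x) mulr_natl mulr2n addrA (addrC (excess a x)).
have L1x := L1_shift_powR x a0; have L10 := L1_shift_powR 0 a0.
rewrite /absmom -(ExD L1x L10) -(ExZl _ (L1D L1x L10)).
rewrite -[leLHS](Ex_cst G); apply: le_Ex; first exact: L1_cst.
  exact/L1Zl/L1D.
move=> y; have := powR_normD_le (x + y) (- y) a0.
by rewrite addrK normrN add0r.
Qed.

Lemma excess_ge0 (a x : R) : 0 < a -> 0 <= excess a x.
Proof.
move=> a0; have [|c c0 H] := @excess_ge_sqr a (`|x| + 1) a0.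
  by rewrite ltr_wpDl.
have hx : `|x| <= `|x| + 1 by rewrite lerDl.
by apply: le_trans (H x hx); rewrite mulr_ge0 ?sqr_ge0 ?(ltW c0).
Qed.

Lemma excess_gt0 (a delta : R) : 0 < a -> 0 < delta ->
  exists2 c, 0 < c & forall x, delta <= `|x| -> c <= excess a x.
Proof.
(* By [normr_powR_le_excess], |x|^a >= D forces an excess of at least 1; below [M], the a-th root of
   [D], the quadratic bound applies. *)
move=> a0 d0; pose D := 2 `^ a * (1 + 2 * absmom a 0) : R.
have D20 : 0 < 2 `^ a :> R by rewrite powR_gt0.
have D0 : 0 < D by rewrite mulr_gt0// ltr_pwDl// mulr_ge0// absmom_ge0.
pose M := D `^ a^-1; have M0 : 0 < M by rewrite powR_gt0.
have [c c0 H] := excess_ge_sqr a0 M0.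
exists (Num.min 1 (c * delta ^+ 2)); first by rewrite lt_min ltr01 mulr_gt0 ?exprn_gt0.
move=> x dx; rewrite ge_min; have [xM|Mx] := leP `|x| M; apply/orP; [right|left].
  apply: le_trans (H x xM); rewrite ler_wpM2l ?(ltW c0)//.
  by rewrite -(real_normK (num_real x)) lerXn2r ?nnegrE// ltW.
have : D <= `|x| `^ a.
  have -> : D = M `^ a by rewrite -powRrM mulVf ?gt_eqF// powRr1// ltW.
  by rewrite ge0_ler_powR ?nnegrE ?(ltW a0) ?(ltW M0)// ltW.
move=> /le_trans /(_ (normr_powR_le_excess x a0)).
by rewrite ler_pM2l// lerD2r.
Qed.

(** Integrate Clarkson's inequality over y: by symmetry of the normal law, |x + y|^a and |x - y|^a
    have the same expectation. *)
Lemma powR_le_excess (a x : R) : 2 <= a -> `|x| `^ a <= excess a x.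
Proof.
move=> a2; have a0 : 0 < a by apply: lt_le_trans a2.
have L1x := L1_shift_powR x a0; have L10 := L1_shift_powR 0 a0.
have mx := measurable_normr_powR a x.
have LNx : L1 G (fun y => `|x - y| `^ a).
  have := L1_shift_powR (- x) a0.
  by under [fun _ => _]eq_fun do rewrite addrC distrC.
have EN : Ex G (fun y => `|x - y| `^ a) = absmom a x.
  have := ge0_gauss_opp mx (fun y => powR_ge0 _ _).
  by rewrite /absmom /Ex /Rintegral => ->.
rewrite /excess lerBrDr.
suff : 2 * (`|x| `^ a + absmom a 0) <= absmom a x + Ex G (fun y => `|x - y| `^ a).
  rewrite EN => h; rewrite -(ler_pM2l (ltr0Sn R 1)).
  by apply: le_trans h _; rewrite mulr_natl mulr2n.
rewrite /absmom -(ExD L1x LNx) -{1}(Ex_cst G (`|x| `^ a)).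
rewrite -(ExD (L1_cst _ _) L10) -(ExZl _ (L1D (L1_cst _ _) L10)).
apply: le_Ex; [|exact: L1D|move=> y].
  by apply/L1Zl/L1D => //; exact: L1_cst.
by rewrite add0r; apply: powR_norm_clarkson.
Qed.

(** The variance is at most the mean square distance to |x|^a, which [powR_norm_perturb] bounds by 2
    f^2 |x|^(2a) plus a constant; |x|^(2a) is in turn at most a multiple of the squared excess plus
    a constant. The choice of [f] brings the final coefficient below [e], using f^2 <= f. *)
Lemma powR_variance_le (a e : R) : 0 < a -> 0 < e -> exists2 C, 0 <= C &
  forall x, Ex G (fun y => (`|x + y| `^ a) ^+ 2) - absmom a x ^+ 2 <=
            C + e * excess a x ^+ 2.
Proof.
move=> a0 e0; pose D : R := 2 `^ a; have D0 : 0 < D by rewrite powR_gt0.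
pose f := Num.min 1 (e / (4 * D ^+ 2)).
have D2 : 0 < 4 * D ^+ 2 by rewrite mulr_gt0 ?exprn_gt0.
have f0 : 0 < f by rewrite lt_min ltr01 divr_gt0.
have f1 : f <= 1 by rewrite ge_min lexx.
have fe : f * (4 * D ^+ 2) <= e by rewrite -ler_pdivlMr// ge_min lexx orbT.
have [C C0 HC] := powR_norm_perturb a0 f0.
pose m := absmom a 0; pose m2 := Ex G (fun y => (`|0 + y| `^ a) ^+ 2).
have m20 : 0 <= m2 by apply: Ex_ge0 => y; exact: sqr_ge0.
exists (16 * f ^+ 2 * D ^+ 2 * m ^+ 2 + 2 * C ^+ 2 * m2).
  have fge0 := ltW f0; have Dge0 := ltW D0; have mge0 : 0 <= m := absmom_ge0 _ _.
  by rewrite addr_ge0// !mulr_ge0.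
move=> x; pose A := `|x| `^ a.
have L1x := L1_shift_powR x a0; have L2x := L1_shift_powR_sqr x a0.
have L20 := L1_shift_powR_sqr 0 a0.
have LA : L1 G (fun y => (`|x + y| `^ a) ^+ 2 - 2 * A * `|x + y| `^ a).
  by apply: L1B => //; exact: L1Zl.
have EA : Ex G (fun y => (`|x + y| `^ a - A) ^+ 2) =
    Ex G (fun y => (`|x + y| `^ a) ^+ 2) - 2 * A * absmom a x + A ^+ 2.
  rewrite -(ExZl _ L1x) -(ExB L2x (L1Zl _ L1x)) -[A ^+ 2](Ex_cst G).
  rewrite -(ExD LA (L1_cst _ _)); apply: eq_Rintegral => y _; ring.
have LAA : L1 G (fun y => (`|x + y| `^ a - A) ^+ 2).
  have := L1D LA (L1_cst G (A ^+ 2)); congr (is_true (L1 G _)).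
  by apply/funext => y; ring.
have EB : Ex G (fun y => (`|x + y| `^ a - A) ^+ 2) <=
    2 * f ^+ 2 * A ^+ 2 + 2 * C ^+ 2 * m2.
  rewrite -(ExZl _ L20) -[X in _ <= X + _](Ex_cst G) -(ExD (L1_cst _ _) (L1Zl _ L20)).
  apply: le_Ex => //; first by apply: L1D; [exact: L1_cst|exact: L1Zl].
  move=> y; rewrite add0r -real_normK ?num_real//.
  have h : `| `|x + y| `^ a - A| ^+ 2 <= (f * A + C * `|y| `^ a) ^+ 2.
    apply: lerXn2r (HC x y); rewrite nnegrE ?normr_ge0//.
    by rewrite addr_ge0// mulr_ge0 ?powR_ge0// ltW.
  apply: le_trans h _.
  have := sqr_ge0 (f * A - C * `|y| `^ a); nra.
have A0 : 0 <= A by exact: powR_ge0.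
have h0 := excess_ge0 x a0.
have m0 : 0 <= m := absmom_ge0 _ _.
have hA : A ^+ 2 <= (D * (excess a x + 2 * m)) ^+ 2.
  apply: lerXn2r (normr_powR_le_excess x a0); rewrite nnegrE//.
  by rewrite mulr_ge0 ?(ltW D0)// addr_ge0// mulr_ge0.
have hA2 : A ^+ 2 <= D ^+ 2 * (2 * excess a x ^+ 2 + 8 * m ^+ 2).
  apply: le_trans hA _; rewrite exprMn ler_wpM2l ?sqr_ge0//.
  have := sqr_ge0 (excess a x - 2 * m); nra.
have hf : 2 * f ^+ 2 * A ^+ 2 <=
    16 * f ^+ 2 * D ^+ 2 * m ^+ 2 + f * (4 * D ^+ 2) * excess a x ^+ 2.
  apply: (@le_trans _ _ (2 * f ^+ 2 * (D ^+ 2 * (2 * excess a x ^+ 2 + 8 * m ^+ 2)))).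
    by rewrite ler_wpM2l// mulr_ge0 ?sqr_ge0.
  have -> : 2 * f ^+ 2 * (D ^+ 2 * (2 * excess a x ^+ 2 + 8 * m ^+ 2)) =
    16 * f ^+ 2 * D ^+ 2 * m ^+ 2 + f ^+ 2 * (4 * D ^+ 2 * excess a x ^+ 2) by ring.
  have f2 : f ^+ 2 <= f by rewrite expr2 ler_piMl ?(ltW f0).
  by rewrite lerD2l -[leRHS]mulrA ler_wpM2r// !mulr_ge0 ?(ltW D0).
have he := ler_wpM2r (sqr_ge0 (excess a x)) fe.
have := sqr_ge0 (absmom a x - A); rewrite sqrrB; nra.
Qed.

Lemma shift_powR_sqr_bounded (a M : R) : 0 < a -> 0 <= M ->
  exists2 S, 0 < S & forall x, `|x| <= M ->
    Ex G (fun y => (`|x + y| `^ a) ^+ 2) <= S.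
Proof.
move=> a0 M0; pose b := a * 2; have b0 : 0 < b by rewrite mulr_gt0.
have L0 := L1_normr_powR b0.
pose m := Ex G (fun y => `|y| `^ b).
have m0 : 0 <= m by apply: Ex_ge0 => y; exact: powR_ge0.
exists (2 `^ b * (M `^ b + m) + 1).
  by rewrite ltr_wpDl// mulr_ge0 ?addr_ge0 ?powR_ge0.
move=> x xM; apply: le_trans (ler_wpDr ler01 (lexx _)).
rewrite -[X in X + m](Ex_cst G) -(ExD (L1_cst _ _) L0).
rewrite -(ExZl _ (L1D (L1_cst _ _) L0)).
apply: le_Ex; first exact: L1_shift_powR_sqr.
  by apply/L1Zl/L1D => //; exact: L1_cst.
move=> y; rewrite powR_sqr//; apply: (le_trans (powR_normD_le x y b0)).
by rewrite ler_wpM2l ?powR_ge0// lerD2r ge0_ler_powR ?nnegrE ?(ltW b0).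
Qed.

(** The covariance is the expectation of (1_B - p)(|x+y|^a - 1), whose factors have opposite signs
    on either side of |x+y| = 1. Uniformity in x comes from [A], where |x+y| >= 2 whenever |x| <=
    M. *)
Lemma indic_powR_cov (a M : R) : 0 < a -> 0 <= M ->
  exists2 c, 0 < c & forall x, `|x| <= M ->
    Ex G (fun y => \1_[set z | `|x + z| <= 1] y * `|x + y| `^ a) -
    Ex G (\1_[set z | `|x + z| <= 1]) * absmom a x <= - c.
Proof.
move=> a0 M0; pose A : set R := `[2 + M, 3 + M]%classic.
have LA : L1 G (\1_A : R -> R) by apply: L1_indic; exact: measurable_itv.
have t1 : 0 < 2 `^ a - 1 :> R.
  have p1 : (1 : R) `^ a = 1 by rewrite powR1.
  by rewrite subr_gt0 -[ltLHS]p1; apply: gt0_ltr_powR; rewrite ?nnegrE// ltr1n.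
have EA : phi (3 + M) <= Ex G (\1_A).
  have := @gauss_itv_ge (3 + M) (2 + M) (3 + M).
  rewrite (_ : 3 + M - (2 + M) = 1) ?mul1r; last by ring.
  by apply; rewrite ?ger0_norm; lra.
exists (2 * phi (M + 1) * (2 `^ a - 1) * phi (3 + M)).
  by rewrite !mulr_gt0 ?gauss_pdf_gt0.
move=> x xM; set B := [set z | _].
have [x1 x2] : - M <= x /\ x <= M by apply/andP; rewrite -ler_norml.
have BE : B = `[- 1 - x, 1 - x]%classic.
  by apply/seteqP; split=> y; rewrite /B/= in_itv/= ler_norml lerBrDl lerBlDl.
have mB : measurable B by rewrite BE.
have LB : L1 G (\1_B : R -> R) by exact: L1_indic.
pose p := Ex G (\1_B).
have p0 : 2 * phi (M + 1) <= p.
  have := @gauss_itv_ge (M + 1) (- 1 - x) (1 - x).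
  rewrite (_ : 1 - x - (- 1 - x) = 2) -?BE; last by ring.
  by apply; rewrite ?ler_norml; (try (apply/andP; split)); lra.
have p1 : p <= 1.
  by rewrite -(Ex_cst G 1); apply: le_Ex => //; exact: L1_cst.
have pge0 : 0 <= p.
  by apply: le_trans p0; rewrite mulr_ge0//; exact: (ltW (gauss_pdf_gt0 _)).
have L1x := L1_shift_powR x a0.
have LBY : L1 G (fun y => \1_B y * `|x + y| `^ a).
  apply: (L1_le _ _ L1x).
    by apply: measurable_funM; [exact: measurable_indic|exact: measurable_normr_powR].
  move=> y; rewrite indicE; case: (_ \in _); rewrite ?mul1r ?mul0r ?normr0 ?powR_ge0//.
  by rewrite ger0_norm ?powR_ge0.
have LpY : L1 G (fun y => p * `|x + y| `^ a) by exact: L1Zl.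
have Lc : L1 G (fun y => \1_B y * `|x + y| `^ a - p * `|x + y| `^ a) by exact: L1B.
have LBp : L1 G (fun y => \1_B y - p) by apply: L1B => //; exact: L1_cst.
have E : Ex G (fun y => (\1_B y * `|x + y| `^ a - p * `|x + y| `^ a) - (\1_B y - p)) =
    Ex G (fun y => \1_B y * `|x + y| `^ a) - p * absmom a x.
  rewrite (ExB Lc LBp) (ExB LBY LpY) (ExZl _ L1x) (ExB LB (L1_cst _ _)) Ex_cst.
  by rewrite -/p subrr subr0.
rewrite -/p -E.
apply: (@le_trans _ _ (Ex G (fun y => (- (p * (2 `^ a - 1))) * \1_A y))); last first.
  rewrite (ExZl _ LA) mulNr lerN2.
  have h1 := gauss_pdf_gt0 (3 + M); have h2 := gauss_pdf_gt0 (M + 1).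
  apply: ler_pM => //; rewrite ?(ltW h1)//.
    by rewrite !mulr_ge0// ltW.
  by rewrite ler_wpM2r// ltW.
apply: le_Ex; [exact: L1B|exact: L1Zl|move=> y].
have -> : \1_B y * `|x + y| `^ a - p * `|x + y| `^ a - (\1_B y - p) =
   (\1_B y - p) * (`|x + y| `^ a - 1) by ring.
have one : (1 : R) `^ a = 1 by rewrite powR1.
rewrite !indicE; case: (boolP (y \in B)) => [/set_mem yB|/negP yB].
  rewrite memNset; last first.
    rewrite /A/= in_itv/= => /andP[yM _]; move: yB; rewrite /B/= ler_norml; lra.
  rewrite mulr0 mulr_ge0_le0 ?subr_ge0// subr_le0 -[leRHS]one.
  by rewrite ge0_ler_powR ?nnegrE ?(ltW a0).
have xy1 : 1 < `|x + y| by rewrite ltNge; apply/negP => h; apply: yB; exact/mem_set.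
rewrite sub0r; case: (boolP (y \in A)) => [/set_mem|_]; last first.
  rewrite mulr0 mulr_le0_ge0 ?oppr_le0// subr_ge0 -[leLHS]one.
  by rewrite ge0_ler_powR ?nnegrE ?(ltW a0)// ltW.
rewrite /A/= in_itv/= => /andP[yM _].
rewrite mulr1 mulNr lerN2 ler_wpM2l// lerD2r ge0_ler_powR ?nnegrE ?(ltW a0)//.
by rewrite ger0_norm; lra.
Qed.

End excess_moments.

(** * Power of the norm tests *)

Section power_of_norm_tests.
Context (disp : measure_display) (T : measurableType disp) (R : realType).
Variables (P : probability T R) (eps : nat -> {RV P >-> R}).
Hypothesis heps : iid_standard_normal eps.
Variables (a : R).
Hypothesis a0 : 0 < a.

Local Notation G := (@gauss R : probability R R).
Local Notation absmom0 := (absmom a (0 : R)).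

Definition stat (d : nat) (th : nat -> R) (w : T) : R :=
  \sum_(i < d) `|th i + eps i w| `^ a.

Definition power (c : R) (d : nat) (th : nat -> R) : R :=
  Ex P \1_[set w | c <= stat d th w].

Lemma measurable_stat d th : measurable_fun [set: T] (stat d th).
Proof.
apply: measurable_sum => i.
by apply: (measurableT_comp (measurable_normr_powR a (th i))).
Qed.

Lemma measurable_stat_ge c d th : measurable [set w | c <= stat d th w].
Proof.
rewrite -[X in measurable X]setTI.
have -> : [set w | c <= stat d th w] = stat d th @^-1` `[c, +oo[.
  by apply/seteqP; split => x; rewrite /= in_itv/= andbT.
exact: measurable_stat.
Qed.

Lemma power_le1 c d th : power c d th <= 1.
Proof.
rewrite -(Ex_cst P 1); apply: le_Ex.
- exact/L1_indic/measurable_stat_ge.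
- exact: L1_cst.
- by move=> w; rewrite indicE; case: (_ \in _); rewrite ?ler01.
Qed.

Lemma power_compl c d th :
  1 - power c d th = Ex P \1_(~` [set w | c <= stat d th w]).
Proof.
have mA := measurable_stat_ge c d th.
rewrite /power -[in LHS](Ex_cst P 1) -ExB//; last 2 first.
- exact: L1_cst.
- exact: L1_indic.
apply: eq_Rintegral => w _; rewrite !indicE in_setC.
by case: (_ \in _); rewrite /= ?subrr ?subr0.
Qed.

Lemma stat_chebyshev d th (t : R) (A : set T) : 0 < t -> measurable A ->
  (forall w, A w -> t <= `|stat d th w - \sum_(i < d) absmom a (th i)|) ->
  Ex P \1_A <= (\sum_(i < d) (Ex G (fun y => (`|th i + y| `^ a) ^+ 2) -
                              absmom a (th i) ^+ 2)) / t ^+ 2.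
Proof.
move=> t0 mA At.
have E1 i : (fun y => 1 * `|th i + y| `^ a) = (fun y => `|th i + y| `^ a).
  by apply/funext => y; rewrite mul1r.
have E2 i : (fun y => 1 * (`|th i + y| `^ a) ^+ 2) = (fun y => (`|th i + y| `^ a) ^+ 2).
  by apply/funext => y; rewrite mul1r.
have E3 : (fun w => \prod_(i < d) (1 : R) * \1_A w) = (\1_A : T -> R).
  by apply/funext => w; rewrite big1// mul1r.
have -> : \sum_(i < d) (Ex G (fun y => (`|th i + y| `^ a) ^+ 2) -
      absmom a (th i) ^+ 2) =
    \sum_(i < d) (Ex G (fun y => 1 * (`|th i + y| `^ a) ^+ 2) -
      Ex G (fun y => 1 * `|th i + y| `^ a) ^+ 2).
  by apply: eq_bigr => i _; rewrite E1 E2.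
rewrite -[in leLHS]E3.
apply: (@weighted_chebyshev _ _ _ _ _ heps d (fun _ _ => 1)
  (fun i y => `|th i + y| `^ a)) => //.
- by move=> i; exact: measurable_normr_powR.
- by move=> i; exact: L1_cst.
- by move=> i; rewrite E2; exact: L1_shift_powR_sqr.
- by move=> i; exact: Ex_cst.
- move=> w Aw; under [X in _ - X]eq_bigr do rewrite E1.
  exact: At.
Qed.

Lemma null_chebyshev d (t : R) (A : set T) : (0 < d)%N -> 0 < t -> measurable A ->
  (forall w, A w -> t * Num.sqrt d%:R <= `|stat d (fun=> 0) w - d%:R * absmom0|) ->
  Ex P \1_A <= Ex G (fun y => (`|0 + y| `^ a) ^+ 2) / t ^+ 2.
Proof.
move=> d0 t0 mA At; have sd : 0 < Num.sqrt (d%:R : R) by rewrite sqrtr_gt0 ltr0n.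
have E : \sum_(i < d) absmom0 = d%:R * absmom0.
  by rewrite sumr_const card_ord mulr_natl.
apply: (le_trans (@stat_chebyshev d (fun=> 0) _ A (mulr_gt0 t0 sd) mA _)).
  by rewrite E.
rewrite sumr_const card_ord exprMn sqr_sqrtr ?ler0n// -[X in X / _]mulr_natr.
rewrite -mulf_div mulfV ?mulr1 ?pnatr_eq0 -?lt0n//.
by rewrite ler_pM2r ?invr_gt0 ?exprn_gt0// gerBl sqr_ge0.
Qed.

Lemma crit_upper (c : nat -> R) (al : R) : 0 < al ->
  power (c d) d (fun=> 0) @[d --> \oo] --> al ->
  exists C N, 0 <= C /\ forall d, (N <= d)%N ->
    c d <= d%:R * absmom0 + C * Num.sqrt d%:R.
Proof.
move=> al0 /cvgrPdist_lt /(_ (al / 2)) => /(_ (divr_gt0 al0 (ltr0Sn _ 1))) [N _ HN].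
pose V := Ex G (fun y => (`|0 + y| `^ a) ^+ 2).
have V0 : 0 <= V by apply: Ex_ge0 => y; exact: sqr_ge0.
(* Since C >= 1 and al C / 2 > V, this gives V / C^2 < al / 2. The threshold [N.+1] below excludes d
   = 0. *)
pose C := 1 + 2 * (V + 1) / al.
have C1 : 1 <= C by rewrite lerDl !mulr_ge0 ?addr_ge0 ?invr_ge0// ltW.
exists C, N.+1; split; first exact: le_trans C1.
move=> d Nd; rewrite leNgt; apply/negP => cd.
have := HN d (ltnW Nd); rewrite /= => pd.
have : power (c d) d (fun=> 0) <= V / C ^+ 2.
  apply: null_chebyshev; [exact: leq_ltn_trans Nd|exact: lt_le_trans C1| |].
    exact: measurable_stat_ge.
  move=> w /= cw; apply: le_trans (ler_norm _).
  by rewrite lerBrDl; apply: le_trans (ltW cd) cw.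
have : V / C ^+ 2 < al / 2.
  rewrite ltr_pdivrMr ?exprn_gt0 ?(lt_le_trans _ C1)//.
  have -> : al / 2 * C ^+ 2 = (al * C) / 2 * C by field.
  have -> : al * C = al + 2 * (V + 1) by rewrite /C; field; rewrite gt_eqF.
  nra.
move: pd; rewrite ltr_norml => /andP[_]; lra.
Qed.

Lemma crit_lower (c : nat -> R) (al : R) : al < 1 ->
  power (c d) d (fun=> 0) @[d --> \oo] --> al ->
  exists C N, 0 <= C /\ forall d, (N <= d)%N ->
    d%:R * absmom0 - C * Num.sqrt d%:R <= c d.
Proof.
move=> al1 /cvgrPdist_lt /(_ ((1 - al) / 2)).
have be0 : 0 < 1 - al by rewrite subr_gt0.
move=> /(_ (divr_gt0 be0 (ltr0Sn _ 1))) [N _ HN].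
pose V := Ex G (fun y => (`|0 + y| `^ a) ^+ 2).
have V0 : 0 <= V by apply: Ex_ge0 => y; exact: sqr_ge0.
pose C := 1 + 2 * (V + 1) / (1 - al).
have C1 : 1 <= C by rewrite lerDl !mulr_ge0 ?addr_ge0 ?invr_ge0// ltW.
exists C, N.+1; split; first exact: le_trans C1.
move=> d Nd; rewrite leNgt; apply/negP => cd.
have := HN d (ltnW Nd); rewrite /= => pd.
have : 1 - power (c d) d (fun=> 0) <= V / C ^+ 2.
  rewrite power_compl.
  apply: null_chebyshev; [exact: leq_ltn_trans Nd|exact: lt_le_trans C1| |].
    exact/measurableC/measurable_stat_ge.
  move=> w /= /negP; rewrite -ltNge => cw; rewrite -normrN opprB.
  apply: le_trans (ler_norm _).
  by have := lt_trans cw cd; lra.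
have : V / C ^+ 2 < (1 - al) / 2.
  rewrite ltr_pdivrMr ?exprn_gt0 ?(lt_le_trans _ C1)//.
  have -> : (1 - al) / 2 * C ^+ 2 = ((1 - al) * C) / 2 * C by field.
  have -> : (1 - al) * C = (1 - al) + 2 * (V + 1) by rewrite /C; field; rewrite gt_eqF.
  nra.
move: pd; rewrite ltr_norml => /andP[+ _]; lra.
Qed.

(** Absorbs the squared excesses of the variance bound into the square of the total excess. *)
Lemma sum_sqr_le d (h : 'I_d -> R) : (forall i, 0 <= h i) ->
  \sum_(i < d) h i ^+ 2 <= (\sum_(i < d) h i) ^+ 2.
Proof.
move=> h0; rewrite expr2 mulr_suml; apply: ler_sum => i _.
rewrite expr2 ler_wpM2l// (bigD1 i)//= lerDl; exact: sumr_ge0.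
Qed.

Lemma power_large (c : nat -> R) :
  (exists C N, 0 <= C /\ forall d, (N <= d)%N ->
    c d <= d%:R * absmom0 + C * Num.sqrt d%:R) ->
  forall eta, 0 < eta -> exists K N, forall d (th : nat -> R), (N <= d)%N ->
    K * Num.sqrt d%:R <= \sum_(i < d) excess a (th i) ->
    1 - eta <= power (c d) d th.
Proof.
move=> [C [N [C0 HC]]] eta eta0.
have [Cv Cv0 HV] := @powR_variance_le R a (eta / 8) a0 (divr_gt0 eta0 (ltr0Sn _ 7)).
(* The summand 1 gives H^2 >= K d, 2C gives C sqrt d <= H/2, and 8 Cv / eta bounds the constant part
   d Cv of the variance by eta H^2 / 8. The variance is then at most eta (H/2)^2. *)
pose K := 1 + 2 * C + 8 * Cv / eta.
have Ce0 : 0 <= 8 * Cv / eta by rewrite divr_ge0 ?mulr_ge0// ltW.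
have K1 : 1 <= K by rewrite /K; lra.
exists K, N.+1 => d th Nd; set H := \sum_(i < d) _ => KH.
have d0 : (0 < d)%N by exact: leq_ltn_trans Nd.
pose sd := Num.sqrt (d%:R : R).
have sd0 : 0 < sd by rewrite sqrtr_gt0 ltr0n.
have sd2 : sd ^+ 2 = d%:R by rewrite sqr_sqrtr// ler0n.
have H0 : 0 < H by apply: lt_le_trans KH; rewrite mulr_gt0// (lt_le_trans _ K1).
have CH : C * sd <= H / 2.
  have : 2 * C * sd <= K * sd by rewrite ler_wpM2r ?(ltW sd0)// /K; lra.
  move: KH; rewrite -/sd; lra.
have EM : \sum_(i < d) absmom a (th i) = d%:R * absmom0 + H.
  under eq_bigr do rewrite absmomE.
  by rewrite big_split/= sumr_const card_ord mulr_natl.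
suff : 1 - power (c d) d th <= eta by lra.
rewrite power_compl.
have H20 : 0 < H / 2 by rewrite divr_gt0.
apply: (le_trans (@stat_chebyshev d th _ _ H20 _ _)).
- exact/measurableC/measurable_stat_ge.
- move=> w /= /negP; rewrite -ltNge => cw; rewrite -normrN opprB.
  apply: le_trans (ler_norm _); rewrite EM.
  have := HC d (ltnW Nd); rewrite -/sd; lra.
rewrite ler_pdivrMr ?exprn_gt0//.
apply: (@le_trans _ _ (d%:R * Cv + eta / 8 * H ^+ 2)).
  apply: (@le_trans _ _ (\sum_(i < d) (Cv + eta / 8 * excess a (th i) ^+ 2))).
    by apply: ler_sum => i _; exact: HV.
  rewrite big_split/= sumr_const card_ord mulr_natl lerD2l -mulr_sumr.
  rewrite ler_wpM2l ?divr_ge0 ?(ltW eta0)//.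
  by apply: (@sum_sqr_le d (fun i => excess a (th i))) => i; exact: excess_ge0.
have : d%:R * Cv <= eta / 8 * H ^+ 2.
  have KH2 : K * d%:R <= H ^+ 2.
    apply: (@le_trans _ _ ((K * sd) ^+ 2)).
      by rewrite exprMn sd2 ler_wpM2r ?ler0n// expr2 ler_peMl// (le_trans _ K1).
    by apply: lerXn2r KH; rewrite nnegrE ?(ltW H0)// mulr_ge0 ?(ltW sd0)// (le_trans _ K1).
  have CK : 8 * Cv <= eta * K.
    rewrite -ler_pdivrMl// mulrC /K; lra.
  have dR : 0 <= (d%:R : R) by rewrite ler0n.
  have := ler_wpM2l dR CK; have := ler_wpM2l (ltW eta0) KH2; lra.
by rewrite expr_div_n; lra.
Qed.

End power_of_norm_tests.

(** * Power bounded away from 1 under bounded shifts *)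

Section contiguity_bound.
Context (disp : measure_display) (T : measurableType disp) (R : realType).
Variables (P : probability T R) (eps : nat -> {RV P >-> R}).
Hypothesis heps : iid_standard_normal eps.
Variables (a : R).
Hypothesis a0 : 0 < a.

Local Notation G := (@gauss R : probability R R).
Local Notation absmom0 := (absmom a (0 : R)).

(* The law is tilted by the density [L], the product of the
   [1 + u * (1_{|X_i| <= 1} - p_i)] with [u] of order [1 / sqrt d]: this shifts
   the mean of the statistic down by a multiple of [sqrt d] that can be chosen
   arbitrarily large, while the second moment of [L] stays bounded. *)
Lemma power_bounded (c : nat -> R) :
  (exists C N, 0 <= C /\ forall d, (N <= d)%N ->
    d%:R * absmom0 - C * Num.sqrt d%:R <= c d) ->
  forall M K, 0 <= M -> 0 <= K -> exists b N, 0 < b /\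
    forall d (th : nat -> R), (N <= d)%N ->
    (forall i, (i < d)%N -> `|th i| <= M) ->
    \sum_(i < d) excess a (th i) <= K * Num.sqrt d%:R ->
    power eps a (c d) d th <= 1 - b.
Proof.
move=> [C [N [C0 HC]]] M K M0 K0.
have [S S0 HS] := @shift_powR_sqr_bounded R a M a0 M0.
have [cv cv0 Hcv] := @indic_powR_cov R a M a0 M0.
(* In units of sqrt d, the downward drift [eta * cv] has to cancel the total excess [K] and the
   slack [C] of the critical value, and leave [2 * S + 1] as the deviation for Chebyshev, where 2S /
   (2S + 1)^2 <= 1/2. *)
pose eta := (C + K + 2 * S + 1) / cv.
have eta0 : 0 <= eta by rewrite divr_ge0 ?(ltW cv0)//; lra.
pose lam := expR (eta ^+ 2); have lam0 : 0 < lam by exact: expR_gt0.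
(* [lam] will bound the second moment of the density, at most (1 + eta^2/d)^d. Beyond the threshold
   d > 0 and eta <= sqrt d, so u <= 1 and the factors of the density are nonnegative. *)
exists (1 / (4 * lam)), (maxn N (Num.truncn (eta ^+ 2)).+1).
split; first by rewrite divr_gt0// mulr_gt0.
move=> d th; rewrite geq_max => /andP[Nd etad] thM HK.
pose sd := Num.sqrt (d%:R : R).
have d0 : (0 < d)%N by exact: leq_ltn_trans etad.
have sd0 : 0 < sd by rewrite sqrtr_gt0 ltr0n.
have sd2 : sd ^+ 2 = d%:R by rewrite sqr_sqrtr// ler0n.
have eta_sd : eta <= sd.
  rewrite -(ger0_norm eta0) -sqrtr_sqr ler_sqrt ?ler0n//.
  by rewrite (le_trans (ltW (truncnS_gt _)))// ler_nat.
pose u := eta / sd.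
have u0 : 0 <= u by rewrite divr_ge0// ltW.
have u1 : u <= 1 by rewrite ler_pdivrMr// mul1r.
pose B i : set R := [set z | `|th i + z| <= 1].
have mB i : measurable (B i).
  have -> : B i = `[- 1 - th i, 1 - th i]%classic.
    by apply/seteqP; split=> y; rewrite /B/= in_itv/= ler_norml lerBrDl lerBlDl.
  exact: measurable_itv.
have LB i : L1 G (\1_(B i) : R -> R) by exact: L1_indic.
pose p i := Ex G (\1_(B i)).
have B01 i y : 0 <= (\1_(B i) y : R) <= 1.
  by rewrite indicE; case: (_ \in _); rewrite lexx ler01.
have p0 i : 0 <= p i by apply: Ex_ge0 => y; case/andP: (B01 i y).
have p1 i : p i <= 1.
  by rewrite -(Ex_cst G 1); apply: le_Ex => //; exact: L1_cst.
pose l i y : R := 1 + u * (\1_(B i) y - p i).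
pose Y i y : R := `|th i + y| `^ a.
have LBp i : L1 G (fun y => \1_(B i) y - p i) by apply: L1B => //; exact: L1_cst.
have Ll i : L1 G (l i) by apply: L1D; [exact: L1_cst|exact: L1Zl].
have ml i : measurable_fun setT (l i) by exact: L1_measurable (Ll i).
have mY i : measurable_fun setT (Y i) by exact: measurable_normr_powR.
have l0 i y : 0 <= l i y.
  have /andP[b0 b1] := B01 i y; have := p0 i; have := p1 i; rewrite /l; nra.
have l2 i y : l i y <= 2.
  have /andP[b0 b1] := B01 i y; have := p0 i; have := p1 i; rewrite /l; nra.
have Y0 i y : 0 <= Y i y by exact: powR_ge0.
have LY i : L1 G (Y i) by exact: L1_shift_powR.
have LY2 i : L1 G (fun y => Y i y ^+ 2) by exact: L1_shift_powR_sqr.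
have LlY2 i : L1 G (fun y => l i y * Y i y ^+ 2).
  apply: (L1_le _ _ (L1Zl 2 (LY2 i))).
    by apply: measurable_funM => //; apply: measurable_funX.
  by move=> y; rewrite ger0_norm ?mulr_ge0 ?sqr_ge0// ler_wpM2r ?sqr_ge0.
have El1 i : Ex G (l i) = 1.
  rewrite (ExD (L1_cst _ _) (L1Zl u (LBp i))) (ExZl _ (LBp i)).
  by rewrite (ExB (LB i) (L1_cst _ _)) !Ex_cst subrr mulr0 addr0.
have LBY i : L1 G (fun y => \1_(B i) y * Y i y).
  apply: (L1_le _ _ (LY i)).
    by apply: measurable_funM => //; exact: measurable_indic.
  move=> y; have /andP[b0 b1] := B01 i y.
  by rewrite ger0_norm ?mulr_ge0// ler_piMl.
have ElY i : (i < d)%N -> Ex G (fun y => l i y * Y i y) <= absmom a (th i) - u * cv.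
  move=> id.
  have LpY : L1 G (fun y => p i * Y i y) by exact: L1Zl.
  have -> : Ex G (fun y => l i y * Y i y) = absmom a (th i) +
      u * (Ex G (fun y => \1_(B i) y * Y i y) - p i * absmom a (th i)).
    rewrite -(ExZl _ (LY i)) -(ExB (LBY i) LpY) -(ExZl _ (L1B (LBY i) LpY)).
    rewrite -(ExD (LY i) (L1Zl _ (L1B (LBY i) LpY))).
    by apply: eq_Rintegral => y _; rewrite /l; ring.
  by rewrite lerD2l -[leRHS]mulrN ler_wpM2l// Hcv// thM.
have ElY2 i : (i < d)%N -> Ex G (fun y => l i y * Y i y ^+ 2) <= 2 * S.
  move=> id; apply: (@le_trans _ _ (2 * Ex G (fun y => Y i y ^+ 2))).
    rewrite -(ExZl _ (LY2 i)); apply: le_Ex => //; first exact: L1Zl.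
    by move=> y; rewrite ler_wpM2r ?sqr_ge0.
  by rewrite ler_wpM2l// HS// thM.
have sum_cst (z : R) : \sum_(i < d) z = d%:R * z.
  by rewrite sumr_const card_ord mulr_natl.
pose L w := \prod_(i < d) l i (eps i w).
pose A := [set w | c d <= stat eps a d th w].
have mA : measurable A by exact: measurable_stat_ge.
have [LL EL] : L1 P L /\ Ex P L = 1.
  exact: (weight_L1 heps d ml mY l0 Y0 Ll LlY2 El1).
have L0 w : 0 <= L w by apply: prodr_ge0.
pose t := (2 * S + 1) * sd.
have t0 : 0 < t by rewrite mulr_gt0//; lra.
have EM : \sum_(i < d) Ex G (fun y => l i y * Y i y) <=
    d%:R * absmom0 - (C + 2 * S + 1) * sd.
  apply: (@le_trans _ _ (\sum_(i < d) (absmom a (th i) - u * cv))).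
    by apply: ler_sum => i _; exact: ElY.
  rewrite big_split/= sum_cst.
  under eq_bigr do rewrite absmomE.
  rewrite big_split/= sum_cst.
  have -> : d%:R * - (u * cv) = - ((C + K + 2 * S + 1) * sd).
    by rewrite -sd2 /u /eta; field; rewrite !gt_eqF.
  by move: HK; rewrite -/sd; lra.
have QA : Ex P (fun w => L w * \1_A w) <= 1 / 2.
  apply: le_trans (weighted_chebyshev heps ml mY l0 Y0 Ll LlY2 El1 t0 mA _) _.
    move=> w cw; have {}cw : c d <= \sum_(i < d) Y i (eps i w) := cw.
    apply: le_trans (ler_norm _).
    by have := HC d Nd; rewrite -/sd lerBrDr /t; move: EM cw; lra.
  rewrite ler_pdivrMr ?exprn_gt0//.
  apply: (@le_trans _ _ (\sum_(i < d) (2 * S))).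
    apply: ler_sum => i _; apply: le_trans (ElY2 i (ltn_ord i)).
    by rewrite gerBl sqr_ge0.
  rewrite sum_cst /t exprMn sd2.
  have dR : 0 <= (d%:R : R) by rewrite ler0n.
  nra.
have LA : L1 P (fun w => L w * \1_A w).
  apply: (L1_le _ _ LL).
    by apply: measurable_funM; [exact: L1_measurable LL|exact: measurable_indic].
  move=> w; rewrite indicE; case: (_ \in _); rewrite ?mulr1 ?mulr0 ?normr0//.
  by rewrite ger0_norm.
have l4 i y : `|l i y ^+ 2| <= 4.
  by rewrite ger0_norm ?sqr_ge0//; have := l0 i y; have := l2 i y; nra.
have ml2 i : measurable_fun setT (fun y => l i y ^+ 2) by apply: measurable_funX.
have Ll2 i : L1 G (fun y => l i y ^+ 2) by exact: (L1_bounded _ (ml2 i) (l4 i)).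
have [LL2 EL2] : L1 P (fun w => L w ^+ 2) /\ Ex P (fun w => L w ^+ 2) <= lam.
  have L2E : (fun w => L w ^+ 2) = (fun w => \prod_(i < d) l i (eps i w) ^+ 2).
    by apply/funext => w; rewrite /L prodrXl.
  rewrite L2E.
  have [LL2 ->] := @indep_Ex_prod _ _ _ _ _ heps d (fun i y => l i y ^+ 2) ml2
    (fun i y => sqr_ge0 _) Ll2.
  split => //; apply: (@le_trans _ _ (\prod_(i < d) (1 + u ^+ 2))).
    apply: ler_prod => i _; rewrite Ex_ge0//=; last by move=> y; exact: sqr_ge0.
    (* Expanding the square of [l i] and bounding (1_B - p)^2 by 1 gives [g], whose linear term is
       centered. *)
    pose g y : R := (1 + u ^+ 2) + 2 * u * (\1_(B i) y - p i).
    have -> : 1 + u ^+ 2 = Ex G g.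
      rewrite (ExD (L1_cst _ _) (L1Zl _ (LBp i))) (ExZl _ (LBp i)).
      by rewrite (ExB (LB i) (L1_cst _ _)) !Ex_cst subrr mulr0 addr0.
    apply: le_Ex => //; first by apply: L1D; [exact: L1_cst|exact: L1Zl].
    move=> y; rewrite /g /l.
    have bp : (\1_(B i) y - p i) ^+ 2 <= 1.
      by have /andP[b0 b1] := B01 i y; have := p0 i; have := p1 i; nra.
    have := ler_wpM2l (sqr_ge0 u) bp; rewrite mulr1; lra.
  rewrite prodr_const card_ord /lam.
  have -> : eta ^+ 2 = d%:R * u ^+ 2.
    by rewrite -sd2 -exprMn /u mulrC divfK// gt_eqF.
  rewrite expRM_natl; apply: lerXn2r; rewrite ?nnegrE ?expR_ge0//.
    by rewrite addr_ge0// sqr_ge0.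
  exact: expR_ge1Dx.
have Lc : L1 P (\1_(~` A) : T -> R) by apply: L1_indic; exact: measurableC.
(* On the acceptance region L <= lam + L^2 / (4 lam), the difference being a square. The left side
   bounds the tilted probability of acceptance from below, and 1/4 bounds the second-moment term. *)
have : 1 - 1 / 2 <= lam * Ex P \1_(~` A) + 1 / 4.
  apply: (@le_trans _ _ (Ex P (fun w => L w - L w * \1_A w))).
    by rewrite ExB// EL; lra.
  apply: (@le_trans _ _ (Ex P (fun w => lam * \1_(~` A) w + (4 * lam)^-1 * L w ^+ 2))).
    apply: le_Ex; [exact: L1B|by apply: L1D; exact: L1Zl|move=> w].
    have c0 : 0 <= (4 * lam)^-1 by rewrite invr_ge0 mulr_ge0// ltW.
    rewrite !indicE in_setC; case: (_ \in _); rewrite /= ?mulr1 ?mulr0 ?subrr ?subr0.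
      by rewrite add0r mulr_ge0 ?sqr_ge0.
    have E : lam + (4 * lam)^-1 * L w ^+ 2 - L w = (4 * lam)^-1 * (L w - 2 * lam) ^+ 2.
      by field; rewrite gt_eqF.
    by rewrite -subr_ge0 E mulr_ge0 ?sqr_ge0.
  rewrite ExD ?ExZl//; [|exact: L1Zl|exact: L1Zl].
  rewrite lerD2l ler_pdivrMl ?mulr_gt0//.
  by apply: le_trans EL2 _; lra.
rewrite -power_compl//.
have lamE : lam * (1 / (4 * lam)) = 1 / 4 by field; rewrite gt_eqF.
move=> h; have : lam * (1 / (4 * lam)) <= lam * (1 - power eps a (c d) d th).
  by rewrite lamE; lra.
by rewrite ler_pM2l//; lra.
Qed.

End contiguity_bound.

(** * Consistency along subsequences *)

Section norm_test_power.
Context (disp : measure_display) (T : measurableType disp) (R : realType).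
Variables (P : probability T R) (eps : nat -> {RV P >-> R}) (a : R).
Hypothesis a0 : 0 < a.

(* The maximum with 0 is needed because [powR] takes the value 1 at negative
   arguments; it does not change the test. *)
Definition crit (kappa : R) : R := Num.max kappa 0 `^ a.

Lemma le_pnorm (kappa : R) d (v : d.-tuple R) :
  (kappa <= pnorm a v) = (crit kappa <= \sum_(i < d) `|tnth v i| `^ a).
Proof.
rewrite /pnorm /crit; set S := \sum_(i < d) _.
have S0 : 0 <= S by apply: sumr_ge0 => i _; exact: powR_ge0.
have m0 : 0 <= Num.max kappa 0 by rewrite le_max lexx orbT.
have ai : 0 <= a^-1 by rewrite invr_ge0 ltW.
apply/idP/idP => h.
  have -> : S = (S `^ a^-1) `^ a by rewrite -powRrM mulVf ?gt_eqF// powRr1.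
  by rewrite ge0_ler_powR ?nnegrE ?(ltW a0) ?powR_ge0// ge_max h powR_ge0.
apply: (@le_trans _ _ (Num.max kappa 0)); first by rewrite le_max lexx.
have -> : Num.max kappa 0 = (Num.max kappa 0 `^ a) `^ a^-1.
  by rewrite -powRrM mulfV ?gt_eqF// powRr1.
by rewrite ge0_ler_powR ?nnegrE ?powR_ge0.
Qed.

Lemma expectation_norm_test (kappa : nat -> R) d (v : T -> d.-tuple R)
  (th : nat -> R) : (forall w (i : 'I_d), tnth (v w) i = th i + eps i w) ->
  'E_P[fun w => norm_test a kappa d (v w)]%E =
  (power eps a (crit (kappa d)) d th)%:E.
Proof.
move=> vE; rewrite unlock /power EFin_Ex; last first.
  exact/L1_indic/measurable_stat_ge.
have E w : (kappa d <= pnorm a (v w)) = (crit (kappa d) <= stat eps a d th w).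
  by rewrite le_pnorm /stat; under eq_bigr do rewrite vE.
apply: eq_integral => w _; congr EFin; rewrite /= !indicE; congr (nat_of_bool _)%:R.
by apply/idP/idP => /set_mem h; apply/mem_set; move: h => /=; rewrite E.
Qed.

End norm_test_power.

(** * Extraction of the subsequence and conclusion *)

Lemma exists_subsequence (Q : nat -> Prop) :
  (forall N, exists2 d, (N <= d)%N & Q d) ->
  exists s, [/\ subsequence s, forall n, Q (s n) & forall n, (n <= s n)%N].
Proof.
move=> HQ.
have [f fP] : {f : nat -> nat & forall N, (N < f N)%N /\ Q (f N)}.
  have H N : exists d, (N < d)%N /\ Q d by have [d Nd Qd] := HQ N.+1; exists d.
  by have [f fP] := choice H; exists f.
(* Iterating once more than the index makes [s 0] positive, as a subsequence requires. *)
pose s n := iter n.+1 f 0%N.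
have sS n : (s n < s n.+1)%N by rewrite /s [iter n.+2 _ _]iterS; exact: (fP _).1.
exists s; split.
- split=> [n|]; first by rewrite /s iterS; exact: leq_ltn_trans (leq0n _) (fP _).1.
  by apply: homo_ltn => //; exact: ltn_trans.
- by move=> n; rewrite /s iterS; exact: (fP _).2.
- by elim=> // n IH; exact: leq_ltn_trans IH (sS n).
Qed.

Lemma excess_le_excess (R : realType) (p q M : R) : 0 < p -> 0 < q -> 0 < M ->
  exists2 C, 0 <= C & forall x, `|x| <= M -> excess q x <= C * excess p x.
Proof.
move=> p0 q0 M0; have [c c0 hc] := excess_ge_sqr p0 M0.
have [C C0 hC] := excess_le_sqr q0 (ltW M0).
exists (C / c) => [|x xM]; first by rewrite divr_ge0// ltW.
apply: le_trans (hC x xM) _; rewrite -mulrA ler_wpM2l// ler_pdivlMl//.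
exact: hc.
Qed.

Lemma max_abs_ge (R : realType) (theta : triangular_array R) d (i : 'I_d) :
  `|tnth (theta d) i| <= max_abs theta d.
Proof. exact: le_bigmax. Qed.

Theorem theorem3p4 (R : realType) (disp : measure_display)
    (T : measurableType disp) (P : probability T R)
    (eps : nat -> {RV P >-> R}) (heps : iid_standard_normal eps)
    (p q : R) (hp : 0 < p) (hpq : p < q)
    (kappa_p kappa_q : nat -> R)
    (hsize_p : exists2 alpha : R, 0 < alpha < 1 &
       asymptotic_size eps (norm_test p kappa_p) alpha)
    (hsize_q : exists2 alpha : R, 0 < alpha < 1 &
       asymptotic_size eps (norm_test q kappa_q) alpha)
    (theta : triangular_array R)
    (htheta : (consistency_set eps (norm_test q kappa_q) `\`
               consistency_set eps (norm_test p kappa_p)) theta) :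
  (forall delta : R, 0 < delta ->
     exists2 s : nat -> nat, subsequence s &
       (sup_exceedance_ratio theta delta s < +oo)%E /\
       max_abs theta (s n) @[n --> \oo] --> +oo) /\
  (2 <= p ->
     exists2 s : nat -> nat, subsequence s &
       (ereal_sup
          [set (delta `^ p)%R%:E * sup_exceedance_ratio theta delta s
          | delta in [set delta : R | (0 < delta)%R]] < +oo)%E /\
       max_abs theta (s n) @[n --> \oo] --> +oo).
Proof.
have hq : 0 < q by apply: lt_trans hpq.
have size_power (a : R) (a0 : 0 < a) kappa : (exists2 alpha : R, 0 < alpha < 1 &
       asymptotic_size eps (norm_test a kappa) alpha) ->
    exists2 alpha : R, 0 < alpha < 1 &
      power eps a (crit a (kappa d)) d (fun=> 0) @[d --> \oo] --> alpha.
  move=> [alpha a01 ha]; exists alpha => //.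
  apply: (fine_cvg (f := fun d => (power eps a (crit a (kappa d)) d (fun=> 0))%:E)).
  rewrite /asymptotic_size in ha.
  under eq_fun do rewrite -(@expectation_norm_test _ _ _ _ eps _ a0 _ _ (noise eps _)
    (fun=> 0) (fun w i => etrans (tnth_mktuple _ _) (esym (add0r _)))).
  exact: ha.
have thE d (i : 'I_d) : tnth (theta d) i = nth 0 (theta d) i by exact: tnth_nth.
have theta_power (a : R) (a0 : 0 < a) kappa d :
    'E_P[fun w => norm_test a kappa d (tuple_add (theta d) (noise eps d w))]%E =
    (power eps a (crit a (kappa d)) d (nth 0 (theta d)))%:E.
  by apply: expectation_norm_test => // w i; rewrite !tnth_mktuple thE.
have [alp /andP[alp0 alp1] /(crit_upper heps hp alp0) critp] := size_power p hp _ hsize_p.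
have [alq /andP[alq0 alq1] /(crit_lower heps hq alq1) critq] := size_power q hq _ hsize_q.
have [hcq hcp] := htheta.
pose H d := \sum_(i < d) excess p (nth 0 (theta d) i).
have [K [K0 HK]] : exists K, 0 <= K /\
    forall N, exists2 d, (N <= d)%N & H d <= K * Num.sqrt d%:R.
  apply: contrapT => /forallNP nK; apply: hcp.
  rewrite /consistency_set /=; under eq_fun do rewrite theta_power//.
  apply/cvg_EFin; first exact: nearW.
  apply/cvgrPdist_le => eta eta0.
  have [K [N KN]] := power_large heps hp critp eta0.
  (* The negated claim concerns nonnegative constants only, whereas the constant from [power_large]
     carries no sign. *)
  have := nK (Num.max K 0); move=> /not_andP[|]; first by rewrite le_max lexx orbT.
  move=> /existsNP[N' hN'].
  exists (maxn N N') => // d /=; rewrite geq_max => /andP[Nd N'd].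
  rewrite ger0_norm ?subr_ge0 ?power_le1// lerBlDr addrC -lerBlDr.
  apply: KN => //; rewrite leNgt; apply/negP => hH; apply: hN'; exists d => //.
  by rewrite (le_trans (ltW hH))// ler_wpM2r ?sqrtr_ge0// le_max lexx.
(* The choice of [s] does not involve delta, so the same subsequence serves both claims. The bound
   [n <= s n] carries thresholds on the dimension over to the index. *)
have [s [ss sH sn]] := exists_subsequence HK.
clear hcp htheta.
have sd0 n : 0 < Num.sqrt ((s n)%:R : R) by rewrite sqrtr_gt0 ltr0n; exact: ss.1.
have smax : max_abs theta (s n) @[n --> \oo] --> +oo.
  apply/cvgryPge => A; pose M := Num.max A 1.
  have M0 : 0 < M by rewrite lt_max ltr01 orbT.
  have [C C0 hC] := excess_le_excess hp hq M0.
  have K'0 : 0 <= C * K := mulr_ge0 C0 K0.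
  have [b [N [b0 hN]]] := power_bounded heps hq critq (ltW M0) K'0.
  have : power eps q (crit q (kappa_q d)) d (nth 0 (theta d)) @[d --> \oo] --> (1 : R).
    apply: (fine_cvg (f := fun d =>
      (power eps q (crit q (kappa_q d)) d (nth 0 (theta d)))%:E)).
    by rewrite -(funext (theta_power q hq kappa_q)); exact: hcq.
  move=> /cvgrPdist_lt /(_ b b0) [N' _ hN'].
  exists (maxn N N'); first exact: I.
  move=> n.
  rewrite [X in X -> _]/= geq_max => /andP[Nn N'n].
  rewrite leNgt; apply/negP => mA.
  have thM i : (i < s n)%N -> `|nth 0 (theta (s n)) i| <= M.
    move=> isn; have := max_abs_ge theta (Ordinal isn); rewrite thE /= => /le_trans.
    by apply; rewrite le_max (ltW mA).
  have := hN' (s n) (leq_trans N'n (sn n)); rewrite /= ltr_norml => /andP[_].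
  suff : power eps q (crit q (kappa_q (s n))) (s n) (nth 0 (theta (s n))) <= 1 - b by lra.
  apply: (hN _ _ (leq_trans Nn (sn n)) thM).
  apply: (@le_trans _ _ (C * H (s n))).
    rewrite /H mulr_sumr; apply: ler_sum => i _; exact: hC (thM _ (ltn_ord i)).
  by rewrite -mulrA; exact: ler_wpM2l (sH n).
(* Markov's inequality for the counting measure: each exceedance contributes at least [c] to
   [H (s n)], which is at most K times sqrt(s n). *)
have ratio_le (delta c : R) n : 0 < c ->
    (forall x, delta < `|x| -> c <= excess p x) ->
    exceedance_ratio theta delta (s n) <= K / c.
  move=> c0 hc; rewrite /exceedance_ratio ler_pdivrMr//.
  rewrite mulrAC ler_pdivlMr//; apply: le_trans (sH n).
  rewrite mulr_suml; apply: ler_sum => i _; rewrite thE.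
  case: ltP => [/hc|_]; first by rewrite mul1r.
  by rewrite mul0r excess_ge0.
split=> [delta d0|p2]; exists s => //; split => //.
  have [c c0 hc] := excess_gt0 hp d0.
  apply: (@le_lt_trans _ _ (K / c)%:E); last by rewrite ltry.
  apply/ge_ereal_sup => _ [n _ <-]; rewrite lee_fin; apply: ratio_le => // x /ltW.
  exact: hc.
apply: (@le_lt_trans _ _ K%:E); last by rewrite ltry.
apply/ge_ereal_sup => _ [delta /= d0 <-].
have dp : 0 < delta `^ p by rewrite powR_gt0.
(* Taking [c] equal to delta^p in [ratio_le] cancels the prefactor, so [K] bounds the weighted
   supremum uniformly in delta. *)
have -> : K = delta `^ p * (K / delta `^ p) by rewrite mulrC divfK// gt_eqF.
rewrite EFinM lee_wpmul2l ?lee_fin ?(ltW dp)//.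
apply/ge_ereal_sup => _ [n _ <-]; rewrite lee_fin; apply: ratio_le => // x dx.
apply: le_trans (powR_le_excess x p2).
by rewrite ge0_ler_powR ?nnegrE ?(ltW hp) ?(ltW d0)// ltW.
Qed.
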